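(* Let $A$ be a Weil algebra of height $l$, let $0\le k\le l$, let $A_k=A/\mathfrak m_A^{k+1}$, and let $M$ be a smooth manifold. The natural projection $M^A\to M^{A_k}$ is endowed with a canonical structure of affine bundle if and only if $2k+1\ge l$.
   Context: Manifolds are nonempty and $C^\infty$. A Weil algebra is a finite-dimensional local commutative $\mathbb R$-algebra with unit and residue field $\mathbb R$; $\mathfrak m_A$ is its maximal ideal. The height of $A$ is the non-negative integer $l$ with $\mathfrak m_A^l\ne0$ and $\mathfrak m_A^{l+1}=0$. $M^A$ is the set of $\mathbb R$-algebra morphisms $p^A\colon C^\infty(M)\to A$, a smooth manifold for which the components of $p^A\mapsto p^A(f)$ in a basis of $A$ are smooth for all $f$. The natural projection $\hat\phi\colon M^A\to M^{A_k}$ is composition with the quotient map $\phi\colon A\to A_k$; it is a fibre bundle. Let $I=\ker\phi=\mathfrak m_A^{k+1}$, $B=A_k$. For $p^A\in M^A$, $\mathrm{Der}_{p^A}(C^\infty(M),I)$ is the space of $\mathbb R$-linear maps $D\colon C^\infty(M)\to I$ with $D(fg)=p^A(f)D(g)+p^A(g)D(f)$. ''Canonical structure of affine bundle'' means the one induced by addition of linear maps: for each $p^B\in M^B$ the space $\mathrm{Der}_{p^A}(C^\infty(M),I)$ is the same for all $p^A\in\hat\phi^{-1}(p^B)$; denoting it $TV_{p^B}$, these spaces are the fibres of a vector bundle over $M^B$; $p^A+D\in\hat\phi^{-1}(p^B)$ for all $p^A\in\hat\phi^{-1}(p^B)$, $D\in TV_{p^B}$; and the resulting smooth map $(p^A,D)\mapsto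 p^A+D$ makes each fibre an affine space modelled on $TV_{p^B}$.
   Formalization: The ''only if'' direction is stated for manifolds M of positive dimension, since in dimension 0 the projection is trivially an affine bundle for every k; the ''if'' direction is stated for every dimension. *)

(* Defs.v *)
Set Warnings "-notation-overridden,-ambiguous-paths".
From HB Require Import structures.
From mathcomp Require Import all_boot all_order all_algebra all_field.
From mathcomp Require Import all_classical all_reals all_analysis.

Set Implicit Arguments.
Unset Strict Implicit.
Unset Printing Implicit Defensive.

Import Order.TTheory GRing.Theory Num.Theory.
Import numFieldNormedType.Exports.
Local Open Scope classical_set_scope.
Local Open Scope ring_scope.

Section SmoothEuclidean.
Variable R : realType.

(* [Ck k U f]: the partial derivatives of [f] of order at most [k] exist and are
   continuous at every point of the open set [U]. *)
Fixpoint Ck m (k : nat) (U : set 'rV[R]_m) (f : 'rV[R]_m -> R) : Prop :=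
  match k with
  | 0 => forall x, U x -> {for x, continuous f}
  | k'.+1 => [/\ forall x, U x -> {for x, continuous f},
      forall i x, U x -> derivable f x (delta_mx 0 i)
      & forall i, Ck k' U ('D_(delta_mx 0 i) f)]
  end.

Definition smooth_on m (U : set 'rV[R]_m) (f : 'rV[R]_m -> R) : Prop :=
  forall k, Ck k U f.

Definition Rn_smooth_at m (f : 'rV[R]_m -> R) (x : 'rV[R]_m) : Prop :=
  exists U, open_nbhs x U /\ smooth_on U f.

Lemma Ck_cont m k (U : set 'rV[R]_m) f x :
  Ck k U f -> U x -> {for x, continuous f}.
Proof. by case: k => [|k] /= => [h|[h _ _]]; apply: h. Qed.

Lemma CkS m k (U : set 'rV[R]_m) f : Ck k.+1 U f -> Ck k U f.
Proof.
elim: k f => [|k IH] f; first by case.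
by case=> ? ? h; split=> // i; apply/IH/h.
Qed.

Lemma near_open m (U : set 'rV[R]_m) (f g : 'rV[R]_m -> R) x :
  open U -> (forall y, U y -> f y = g y) -> U x -> \near x, f x = g x.
Proof. by move=> oU fg Ux; near=> y; apply: fg; near: y; exact: open_nbhs_nbhs.
Unshelve. all: by end_near. Qed.

Lemma near_eq_continuous (T : topologicalType) (f g : T -> R) (x : T) :
  (\near x, f x = g x) -> {for x, continuous f} -> {for x, continuous g}.
Proof.
move=> fg cf; have fgx : f x = g x := nbhs_singleton fg.
have : g @ x --> f x by apply: cvg_trans cf; exact: near_eq_cvg.
by rewrite fgx.
Qed.

Lemma Ck_eq m k (U : set 'rV[R]_m) f g : open U ->
  (forall x, U x -> f x = g x) -> Ck k U f -> Ck k U g.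
Proof.
move=> oU; elim: k f g => [|k IH] f g fg /=.
  by move=> cf x Ux; apply: near_eq_continuous (cf x Ux); exact: near_open fg Ux.
case=> cf df hf; split=> [x Ux|i x Ux|i].
- by apply: near_eq_continuous (cf x Ux); exact: near_open fg Ux.
- by apply: near_eq_derivable (df i x Ux); exact: near_open fg Ux.
- by apply: IH (hf i) => x Ux; apply: near_eq_derive; exact: near_open fg Ux.
Qed.

Lemma CkW m k (U V : set 'rV[R]_m) f : V `<=` U -> Ck k U f -> Ck k V f.
Proof.
move=> VU; elim: k f => [|k IH] f /=; first by move=> h x /VU; exact: h.
by case=> cf df hf; split=> [x /VU|i x /VU|i]; [exact: cf|exact: df|exact/IH/hf].
Qed.

Lemma Ck_cst m k (U : set 'rV[R]_m) (c : R) : Ck k U (fun=> c).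
Proof.
elim: k c => [|k IH] c /=; first by move=> x _; exact: cst_continuous.
split=> [x _|i x _|i]; [exact: cst_continuous|exact: derivable_cst|].
rewrite (_ : 'D_(delta_mx 0 i) _ = fun=> 0); first exact: IH.
by apply/funext => x; rewrite derive_cst.
Qed.

Lemma CkD m k (U : set 'rV[R]_m) f g : open U ->
  Ck k U f -> Ck k U g -> Ck k U (fun x => f x + g x).
Proof.
move=> oU; elim: k f g => [|k IH] f g /=.
  by move=> cf cg x Ux; exact: (cvgD (cf x Ux) (cg x Ux)).
case=> cf df hf [cg dg hg]; split=> [x Ux|i x Ux|i].
- by exact: (cvgD (cf x Ux) (cg x Ux)).
- by apply: derivableD; [exact: df|exact: dg].
- apply: Ck_eq (IH _ _ (hf i) (hg i)) => // x Ux.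
  by rewrite -deriveD; [|exact: df|exact: dg].
Qed.

Lemma CkM m k (U : set 'rV[R]_m) f g : open U ->
  Ck k U f -> Ck k U g -> Ck k U (fun x => f x * g x).
Proof.
move=> oU; elim: k f g => [|k IH] f g.
  by move=> cf cg x Ux; exact: (cvgM (cf x Ux) (cg x Ux)).
move=> hf0 hg0; case: (hf0) => cf df hf; case: (hg0) => cg dg hg.
split=> [x Ux|i x Ux|i].
- by exact: (cvgM (cf x Ux) (cg x Ux)).
- by apply: derivableM; [exact: df|exact: dg].
- apply: Ck_eq (CkD oU (IH _ _ (CkS hf0) (hg i)) (IH _ _ (CkS hg0) (hf i))) => //.
  by move=> x Ux; rewrite [RHS]deriveM; [|exact: df|exact: dg].
Qed.

Lemma growth_comp_lin m1 m2 (L : {linear 'rV[R]_m1 -> 'rV[R]_m2})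
    (f : 'rV[R]_m2 -> R) x v :
  (fun h : R => h^-1 *: (((f \o L) \o shift x) (h *: v) - (f \o L) x)) =
  (fun h : R => h^-1 *: ((f \o shift (L x)) (h *: L v) - f (L x))).
Proof. by apply/funext => h /=; rewrite linearP. Qed.

Lemma derive_comp_lin m1 m2 (L : {linear 'rV[R]_m1 -> 'rV[R]_m2})
    (f : 'rV[R]_m2 -> R) x v :
  'D_v (f \o L) x = 'D_(L v) f (L x).
Proof. by rewrite /derive growth_comp_lin. Qed.

Lemma derivable_comp_lin m1 m2 (L : {linear 'rV[R]_m1 -> 'rV[R]_m2})
    (f : 'rV[R]_m2 -> R) x v :
  derivable f (L x) (L v) -> derivable (f \o L) x v.
Proof. by rewrite /derivable growth_comp_lin. Qed.

Lemma Ck_proj m1 m2 k (L : {linear 'rV[R]_m1 -> 'rV[R]_m2}) f :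
  continuous L ->
  (forall i, L (delta_mx 0 i) = 0 \/ exists j, L (delta_mx 0 i) = delta_mx 0 j) ->
  Ck k setT f -> Ck k setT (f \o L).
Proof.
move=> cL hL; elim: k f => [|k IH] f /=.
  by move=> cf x _; apply: continuous_comp; [exact: cL|exact: cf].
case=> cf df hf; split=> [x _|i x _|i].
- by apply: continuous_comp; [exact: cL|exact: cf].
- apply: derivable_comp_lin.
  by case: (hL i) => [->|[j ->]]; [exact: derivable0|exact: df].
- case: (hL i) => [L0|[j Lj]].
    rewrite (_ : 'D_(delta_mx 0 i) _ = fun=> 0); first exact: Ck_cst.
    by apply/funext => x; rewrite derive_comp_lin L0 derive0.
  rewrite (_ : 'D_(delta_mx 0 i) _ = 'D_(delta_mx 0 j) f \o L); first exact/IH/hf.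
  by apply/funext => x; rewrite derive_comp_lin Lj.
Qed.

Lemma continuous_row m (T : topologicalType) (h : 'I_m -> T -> R) x :
  (forall j, {for x, continuous (h j)}) ->
  {for x, continuous (fun t => \row_j h j t)}.
Proof.
move=> ch A [P hP sPA].
have Ph : \forall t \near x, forall j, P 0 j (h j t).
  apply: filter_forall => j; have := hP 0 j; rewrite mxE; exact: ch.
apply: (@filterS _ (nbhs x) _ _ _ _ Ph) => t Pt.
by apply: sPA => i j; rewrite mxE ord1.
Qed.

End SmoothEuclidean.

(* A functionally structured space (G. Bredon, Topology and Geometry, II.1):
   a topological space with a sheaf of algebras of continuous real functions.
   The sheaf is given by its germs: a function on an open set [U] is a section
   iff it is [smooth_at] every point of [U]. *)
Record smoothSpace (R : realType) := SmoothSpace {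
  space :> topologicalType;
  smooth_at : (space -> R) -> space -> Prop;
  smooth_near : forall f g x,
    (\near x, f x = g x) -> smooth_at f x -> smooth_at g x;
  smooth_open : forall f x, smooth_at f x -> \forall y \near x, smooth_at f y;
  smooth_continuous : forall f x, smooth_at f x -> {for x, continuous f};
  smooth_cst : forall c x, smooth_at (fun=> c) x;
  smoothD : forall f g x, smooth_at f x -> smooth_at g x ->
    smooth_at (fun y => f y + g y) x;
  smoothM : forall f g x, smooth_at f x -> smooth_at g x ->
    smooth_at (fun y => f y * g y) x }.

Section EuclideanSpace.
Variables (R : realType) (m : nat).

Lemma Rn_smooth_near f g (x : 'rV[R]_m) :
  (\near x, f x = g x) -> Rn_smooth_at f x -> Rn_smooth_at g x.
Proof.
move=> fg0; have : nbhs x [set y | f y = g y] by [].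
rewrite nbhsE => -[V [oV Vx] fg] [U [[oU Ux] sf]].
exists (U `&` V); split; first by split; [exact: openI|].
move=> k; apply: (@Ck_eq _ _ _ _ f); first exact: openI.
  by move=> y [_ /fg].
by apply: CkW (sf k) => y [].
Qed.

Lemma Rn_smooth_open f (x : 'rV[R]_m) :
  Rn_smooth_at f x -> \forall y \near x, Rn_smooth_at f y.
Proof.
move=> [U [[oU Ux] sf]]; near=> y; exists U; split=> //; split=> //.
by near: y; exact: open_nbhs_nbhs.
Unshelve. all: by end_near. Qed.

Lemma Rn_smooth_continuous f (x : 'rV[R]_m) :
  Rn_smooth_at f x -> {for x, continuous f}.
Proof. by move=> [U [[oU Ux] sf]]; exact: Ck_cont (sf 0) Ux. Qed.

Lemma Rn_smooth_cst c (x : 'rV[R]_m) : Rn_smooth_at (fun=> c) x.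
Proof. by exists setT; split=> [|k]; [exact: open_nbhsT|exact: Ck_cst]. Qed.

Lemma Rn_smooth2 (op : R -> R -> R) f g (x : 'rV[R]_m) :
  (forall k (U : set 'rV[R]_m) f g, open U -> Ck k U f -> Ck k U g ->
     Ck k U (fun y => op (f y) (g y))) ->
  Rn_smooth_at f x -> Rn_smooth_at g x ->
  Rn_smooth_at (fun y => op (f y) (g y)) x.
Proof.
move=> hop [U [[oU Ux] sf]] [V [[oV Vx] sg]].
exists (U `&` V); split; first by split; [exact: openI|].
by move=> k; apply: hop; [exact: openI|apply: CkW (sf k)|apply: CkW (sg k)] => y [].
Qed.

Definition euclidean : smoothSpace R :=
  @SmoothSpace R 'rV[R]_m (@Rn_smooth_at R m) Rn_smooth_near Rn_smooth_open
    Rn_smooth_continuous Rn_smooth_cst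
    (fun f g x => Rn_smooth2 (@CkD R m)) (fun f g x => Rn_smooth2 (@CkM R m)).

End EuclideanSpace.

(* The initial smooth structure on [S] for maps [u i : S -> Y i]: the initial
   topology, and the functions locally of the form [F (h_1, ..., h_m)] with [F]
   smooth on R^m and each [h_j] the pull-back of a smooth function germ by
   some [u i].  On an embedded submanifold of a finite product of manifolds it
   is the usual smooth structure. *)
Section InitialSpace.
Variables (R : realType) (S I : Type) (Y : I -> smoothSpace R).
Variable u : forall i, S -> Y i.

Definition initial_top : topologicalType :=
  initial_topology (fun s : {classic S} => (u ^~ s : prod_topology Y)).

Definition pulled_back (h : S -> R) (s : S) : Prop :=
  exists i (g : Y i -> R), smooth_at g (u i s) /\ h = g \o u i.

Definition initial_smooth_at (f : initial_top -> R) (s : initial_top) : Prop :=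
  exists m (h : 'I_m -> S -> R) (F : 'rV[R]_m -> R),
    [/\ forall j, pulled_back (h j) s, smooth_on setT F
      & \forall t \near s, f t = F (\row_j h j t)].

Lemma prod_ev_continuous i : continuous (fun g : prod_topology Y => g i).
Proof.
move=> g; have /cvg_sup/(_ i) gi : g --> g by apply: cvg_id.
move=> A /(@initial_continuous _ _ (fun g : forall i, Y i => g i)).
exact: gi.
Qed.

Lemma initial_u_continuous i : continuous (u i : initial_top -> Y i).
Proof.
move=> s; apply: (@continuous_comp initial_top (prod_topology Y) (Y i)
  (fun s => u ^~ s) (fun g => g i)); first exact: initial_continuous.
exact: prod_ev_continuous.
Qed.

Lemma pulled_back_continuous h (s : initial_top) :
  pulled_back h s -> {for s, continuous (h : initial_top -> R)}.
Proof.
move=> [i [g [sg ->]]].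
apply: (@continuous_comp initial_top _ _ (u i) g); first exact: initial_u_continuous.
exact: smooth_continuous sg.
Qed.

Lemma initial_smooth_near f g s : (\near s, f s = g s) ->
  initial_smooth_at f s -> initial_smooth_at g s.
Proof.
move=> fg [m [h [F [hh sF ff]]]]; exists m, h, F; split=> //.
by apply: filterS2 fg ff => t <-.
Qed.

Lemma initial_smooth_open f s : initial_smooth_at f s ->
  \forall t \near s, initial_smooth_at f t.
Proof.
move=> [m [h [F [hh sF ff]]]].
have hn : \forall t \near s, forall j, pulled_back (h j) t.
  apply: (@filter_forall _ _ (fun j => pulled_back (h j)) (nbhs s)) => j.
  have [i [g [sg ->]]] := hh j.
  have gn : \forall t \near s, smooth_at g (u i t).
    exact: initial_u_continuous (smooth_open sg).
  by apply: filterS gn => t st; exists i, g.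
have /nbhs_interior ffn := ff.
by apply: filterS2 hn ffn => t ht ft; exists m, h, F.
Qed.

Lemma initial_smooth_continuous f s : initial_smooth_at f s ->
  {for s, continuous f}.
Proof.
move=> [m [h [F [hh sF ff]]]].
apply: (@near_eq_continuous _ initial_top (fun t => F (\row_j h j t))).
  by apply: filterS ff => t ->.
apply: (@continuous_comp initial_top _ _ (fun t => \row_j h j t) F).
  by apply: continuous_row => j; exact: pulled_back_continuous.
exact: (Ck_cont (sF 0)) Logic.I.
Qed.

Lemma initial_smooth_cst c s : initial_smooth_at (fun=> c) s.
Proof.
exists 0, (fun _ _ => 0), (fun=> c); split=> [[]//|k|]; first exact: Ck_cst.
exact: filterE.
Qed.

Lemma lsubmx_delta m n (i : 'I_(m + n)) : let L := lsubmx in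
  L (delta_mx 0 i : 'rV[R]_(m + n)) = 0 \/
  exists j, L (delta_mx 0 i : 'rV[R]_(m + n)) = delta_mx 0 j.
Proof.
rewrite /=; case: (split_ordP i) => j ->; [right; exists j|left];
  by apply/rowP => l; rewrite !mxE !eqxx /= ?(inj_eq (@lshift_inj _ _)) ?eq_lrshift.
Qed.

Lemma rsubmx_delta m n (i : 'I_(m + n)) : let L := rsubmx in
  L (delta_mx 0 i : 'rV[R]_(m + n)) = 0 \/
  exists j, L (delta_mx 0 i : 'rV[R]_(m + n)) = delta_mx 0 j.
Proof.
rewrite /=; case: (split_ordP i) => j ->; [left|right; exists j];
  by apply/rowP => l; rewrite !mxE !eqxx /= ?(inj_eq (@rshift_inj _ _)) ?eq_rlshift.
Qed.

Lemma initial_smooth2 (op : R -> R -> R) f g s :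
  (forall m k (U : set 'rV[R]_m) f g, open U -> Ck k U f -> Ck k U g ->
     Ck k U (fun y => op (f y) (g y))) ->
  initial_smooth_at f s -> initial_smooth_at g s ->
  initial_smooth_at (fun y => op (f y) (g y)) s.
Proof.
move=> hop [m [h [F [hh sF ff]]]] [n [l [G [hl sG gg]]]].
exists (m + n)%N, (fun j t => match fintype.split j with inl a => h a t | inr b => l b t end),
  (fun v => op (F (lsubmx v)) (G (rsubmx v))); split.
- by move=> j; case: fintype.split => a; [exact: hh|exact: hl].
- move=> k; apply: hop; first exact: openT.
    apply: (@Ck_proj R _ _ k lsubmx F); [exact: continuous_lsubmx| |exact: sF].
    exact: lsubmx_delta.
  apply: (@Ck_proj R _ _ k rsubmx G); [exact: continuous_rsubmx| |exact: sG].
  exact: rsubmx_delta.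
- apply: filterS2 ff gg => t -> ->; congr (op (F _) (G _)); apply/rowP => j.
    by rewrite !mxE (unsplitK (inl _ j)).
  by rewrite !mxE (unsplitK (inr _ j)).
Qed.

Definition initial_space : smoothSpace R :=
  @SmoothSpace R initial_top initial_smooth_at initial_smooth_near
    initial_smooth_open initial_smooth_continuous initial_smooth_cst
    (fun f g s => initial_smooth2 (fun m => @CkD R m))
    (fun f g s => initial_smooth2 (fun m => @CkM R m)).

End InitialSpace.

Section SmoothMaps.
Variable R : realType.

(* [initial_space] for two maps *)
Definition pair_family (X Y : smoothSpace R) (b : bool) : smoothSpace R :=
  if b then X else Y.

Definition pair_maps (X Y : smoothSpace R) S (u : S -> X) (v : S -> Y) (b : bool) :
    S -> pair_family X Y b :=
  match b with true => u | false => v end.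

Definition initial2_space (X Y : smoothSpace R) S (u : S -> X) (v : S -> Y) :
    smoothSpace R :=
  initial_space (pair_maps u v).

Definition product_space (X Y : smoothSpace R) : smoothSpace R :=
  @initial2_space X Y (X * Y) fst snd.

Definition fibre_product (X Y Z : smoothSpace R) (u : X -> Z) (v : Y -> Z) :
    smoothSpace R :=
  @initial2_space X Y {s : X * Y | u s.1 = v s.2}
    (fun s => (sval s).1) (fun s => (sval s).2).

Definition smooth_map_at (X Y : smoothSpace R) (u : X -> Y) (x : X) : Prop :=
  {for x, continuous u} /\
  forall f : Y -> R, smooth_at f (u x) -> smooth_at (f \o u) x.

Definition smooth_map (X Y : smoothSpace R) (u : X -> Y) : Prop :=
  forall x, smooth_map_at u x.

(* [u] and [v] restrict to mutually inverse diffeomorphisms between the open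
   sets [U] and [V]; their values elsewhere are irrelevant. *)
Definition diffeo_on (X Y : smoothSpace R) (U : set X) (V : set Y)
    (u : X -> Y) (v : Y -> X) : Prop :=
  [/\ open U /\ open V,
      forall x, U x -> V (u x) /\ v (u x) = x,
      forall y, V y -> U (v y) /\ u (v y) = y,
      forall x, U x -> smooth_map_at u x
    & forall y, V y -> smooth_map_at v y].

(* A smooth manifold of dimension [n] as a functionally structured space locally
   isomorphic to R^n: the charts are diffeomorphisms for the sheaf of smooth
   functions, which is equivalent to the choice of a maximal smooth atlas. *)
Record manifold (n : nat) := Manifold {
  mspace :> smoothSpace R;
  manifold_nonempty : [set: mspace] !=set0;
  manifold_hausdorff : hausdorff_space mspace;
  manifold_second_countable : @second_countable mspace;
  manifold_chart : forall x : mspace, exists U V u v,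
    U x /\ @diffeo_on mspace (euclidean R n) U V u v }.

(* The smooth vector bundles [pi : E -> X] of rank [r] whose fibre over [b] is
   the subspace [F b] of [V]: [vec] identifies each [pi @^-1` [set b]] with [F b],
   and carries its vector space structure. *)
Definition vector_bundle (r : nat) (X : smoothSpace R) (V : lmodType R)
    (F : X -> set V) (E : smoothSpace R) (pi : E -> X) (vec : E -> V) : Prop :=
  [/\ forall b, set_bij (pi @^-1` [set b]) (F b) vec
    & forall b0, exists U (u : E -> product_space X (euclidean R r))
        (v : product_space X (euclidean R r) -> E),
      [/\ U b0,
          diffeo_on (pi @^-1` U) [set w : product_space X (euclidean R r) | U w.1] u v,
          forall e, U (pi e) -> (u e).1 = pi e
        & forall b, U b -> forall (a : R) (s t : 'rV[R]_r),
            vec (v (b, a *: s + t)) = a *: vec (v (b, s)) + vec (v (b, t))]].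

End SmoothMaps.

Section SmoothFunctions.
Variables (R : realType) (n : nat) (M : manifold R n).

Definition smooth_pred : {pred (M -> R)} :=
  fun f => `[< forall x, smooth_at f x >].

(* The algebra C^oo(M) *)
Record smooth_fun := SmoothFun {
  smooth_fun_val :> M -> R;
  _ : smooth_pred smooth_fun_val }.

HB.instance Definition _ := [isSub for smooth_fun_val].
HB.instance Definition _ := [Choice of smooth_fun by <:].

Lemma smooth_subring_closed : subring_closed smooth_pred.
Proof.
split=> [|f g /asboolP sf /asboolP sg|f g /asboolP sf /asboolP sg];
    apply/asboolP => x.
- exact: smooth_cst.
- rewrite (_ : f - g = fun y => f y + -1 * g y).
    by apply: smoothD => //; apply: smoothM => //; exact: smooth_cst.
  by apply/funext => y; rewrite mulN1r.
- exact: smoothM.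
Qed.

Lemma smooth_scaler_closed : scaler_closed smooth_pred.
Proof.
move=> a f /asboolP sf; apply/asboolP => x.
by apply: (@smoothM _ _ (fun=> a)) => //; exact: smooth_cst.
Qed.

HB.instance Definition _ :=
  GRing.isSubringClosed.Build (M -> R) smooth_pred smooth_subring_closed.
HB.instance Definition _ :=
  GRing.SubChoice_isSubComPzRing.Build _ _ smooth_fun smooth_subring_closed.
HB.instance Definition _ :=
  GRing.isScaleClosed.Build R (M -> R) smooth_pred smooth_scaler_closed.
HB.instance Definition _ :=
  GRing.SubZmodule_isSubLmodule.Build _ _ _ smooth_fun
    (GRing.subsemimodClosedP smooth_pred).

Lemma smooth_fun1_neq0 : (1 : smooth_fun) != 0.
Proof.
have [x _] := manifold_nonempty M; apply/eqP => /(congr1 val) /(congr1 (@^~ x)).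
by move/eqP; rewrite oner_eq0.
Qed.

HB.instance Definition _ :=
  GRing.PzSemiRing_isNonZero.Build smooth_fun smooth_fun1_neq0.

Lemma smooth_fun_scalerAl (a : R) (f g : smooth_fun) : a *: (f * g) = (a *: f) * g.
Proof. by apply/val_inj/funext => x; exact: mulrA. Qed.

HB.instance Definition _ :=
  GRing.LSemiModule_isLSemiAlgebra.Build R smooth_fun smooth_fun_scalerAl.

End SmoothFunctions.

Section WeilAlgebras.
Variable R : realType.

(* A finite-dimensional commutative algebra is local iff its non-units form a
   subspace, which is then its maximal ideal; the last axiom says that
   [R -> A / m] is onto. *)
Record weilAlgebra := WeilAlgebra {
  weil_alg :> falgType R;
  weil_max : {vspace weil_alg};
  weil_mulC : commutative (@GRing.mul weil_alg);
  weil_local : forall a : weil_alg, (a \in weil_max) = (a \isn't a GRing.unit);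
  weil_residue : forall a : weil_alg, exists c : R, a - c%:A \in weil_max }.

(* [expv] uses [m ^+ 0 = 1 = <[1]>], which differs from the ideal power [m^0 = A],
   but both are non-zero. *)
Definition height (A : weilAlgebra) (l : nat) : Prop :=
  (weil_max A ^+ l)%VS != 0%VS /\ (weil_max A ^+ l.+1)%VS = 0%VS.

(* [phi] exhibits [B] as the quotient algebra [A / J]. *)
Definition is_quotient (A B : falgType R) (phi : {lrmorphism A -> B})
    (J : {vspace A}) : Prop :=
  (forall b, exists a, phi a = b) /\ (forall a, (phi a == 0) = (a \in J)).

Definition coordinates (A : falgType R) (a : A) : 'rV[R]_(\dim {:A}) :=
  \row_i coord (vbasis {:A}) i a.

Variables (n : nat) (M : manifold R n).

(* [M^A], with the smooth structure generated by the components of [p |-> p f],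
   for all [f] in [C^oo(M)]; for a Weil algebra [A] it is a manifold. *)
Definition weil_bundle (A : falgType R) : smoothSpace R :=
  @initial_space R {lrmorphism smooth_fun M -> A} (smooth_fun M)
    (fun=> euclidean R (\dim {:A})) (fun f p => coordinates (p f)).

Definition weil_mor (A : falgType R) (p : weil_bundle A) : {lrmorphism smooth_fun M -> A} :=
  p.

Definition weil_proj (A B : falgType R) (phi : {lrmorphism A -> B})
    (p : weil_bundle A) : weil_bundle B :=
  phi \o weil_mor p.

(* [Der_p(C^oo(M), J)] *)
Definition derivations (A : falgType R) (J : {vspace A}) (p : weil_bundle A) :
    set (smooth_fun M -> A) :=
  [set D | [/\ forall (c : R) f g, D (c *: f + g) = c *: D f + D g,
      forall f, D f \in J
    & forall f g, D (f * g) = weil_mor p f * D g + weil_mor p g * D f]].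

Section AffineBundle.
Variables (A B : falgType R) (phi : {lrmorphism A -> B}) (J : {vspace A}).

Definition model_space (b : weil_bundle B) : set (smooth_fun M -> A) :=
  \bigcup_(p in weil_proj phi @^-1` [set b]) derivations J p.

(* The vector bundle structure on the family [model_space] is existentially
   quantified, but the smoothness of [add] leaves only one possibility. *)
Definition canonical_affine_bundle : Prop :=
  (forall p q, weil_proj phi p = weil_proj phi q ->
     derivations J p = derivations J q) /\
  exists (r : nat) (E : smoothSpace R) (pi : E -> weil_bundle B)
    (vec : E -> (smooth_fun M -> A))
    (add : fibre_product (weil_proj phi) pi -> weil_bundle A),
    [/\ vector_bundle r model_space pi vec,
        smooth_map add,
        forall p e (pe : weil_proj phi p = pi e),
          let q := add (exist _ (p, e) pe) in
          weil_proj phi q = pi e /\ weil_mor q =1 weil_mor p \+ vec e,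
        forall b, weil_proj phi @^-1` [set b] !=set0
      & forall p q, weil_proj phi p = weil_proj phi q ->
          exists! D, model_space (weil_proj phi p) D /\
            weil_mor q =1 weil_mor p \+ D].

End AffineBundle.

End WeilAlgebras.

(* Main.v *)
Require Import Defs.
From HB Require Import structures.
From mathcomp Require Import all_boot all_order all_algebra all_field.
From mathcomp Require Import all_classical all_reals all_analysis.
From mathcomp Require Import ring lra.

Set Implicit Arguments.
Unset Strict Implicit.
Unset Printing Implicit Defensive.

Import Order.TTheory GRing.Theory Num.Theory.
Import numFieldNormedType.Exports.
Local Open Scope classical_set_scope.
Local Open Scope ring_scope.

(** Let [J] be the power [k + 1] of the maximal ideal of [A], and [B] the
    quotient of [A] by [J].

    Two points [p], [q] of one fibre differ by a map with values in [J].  If the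
    product of any two elements of [J] is zero, then [p f * x = q f * x] for [x]
    in [J], so that [p] and [q] have the same derivations with values in [J];
    moreover [p + D] is again multiplicative ([translate_exists]) and [q - p] is
    a derivation ([difference_derivation]).  Now [J * J] is the power [2k + 2] of
    the maximal ideal, and it vanishes iff [l <= 2k + 1].  Conversely, if [p] and
    [q] have the same derivations and the manifold has positive dimension, then
    comparing the two Leibniz rules for [D (X * X)], where [X] is a local
    coordinate, [p X - q X = a] and [D X = c], gives [2 a c = 0] for all [a], [c]
    in [J] ([derivations_eq_square_zero]).

    Everything else rests on an explicit description of points and derivations.
    A point is based at a point [z] of the manifold, because the characters of
    the algebra of smooth functions are evaluations ([character_eval]).  Let
    [X_i] be coordinates near [z], extended to global functions, and [d_i] the
    partial derivatives, extended to global derivations ([local_coords]).  By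
    Hadamard's lemma and nilpotency, a point over [z] is determined by the
    increments [p X_i - X_i z] in the maximal ideal ([point_ext]); conversely the
    Taylor formula produces a point from arbitrary increments ([taylor_mor]), and
    it is multiplicative because its terms are the divided powers of a
    derivation.  Hence each point over [B] lifts to [A] ([weil_proj_onto]).  In
    the same way a derivation over [p] with values in [J] is
    [D f = sum_i p (d_i f) * s_i] for a unique choice of the [s_i] in [J].

    The model vector bundle is the set of pairs [(b, D)], with the initial
    structure for the projection and the evaluations of [D]; the [s_i] are its
    local coordinates.  Since [J * J = 0], the product [p (d_i f) * s_i] depends
    on the projection of [p] only, and linearly on its values, so that the
    trivializations are diffeomorphisms ([triv_diffeo]); the translation is a sum
    in coordinates.  Smoothness of all these maps is checked on components,
    thanks to the closure of initial spaces under composition with smooth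
    functions of several variables ([initial_composition_closed]), which requires
    the chain rule ([Ck_comp]). *)

(** * Functions with continuous partial derivatives *)

Section DifferentialCalculus.
Variable R : realType.

Lemma mx_norm_le m (v : 'rV[R]_m) (e : R) : 0 <= e ->
  (`|v| <= e) <-> (forall j, `|v 0 j| <= e).
Proof.
move=> e0; rewrite [`|v|]/Num.norm /= mx_normrE; split.
  by move=> /bigmax_leP[_ h] j; exact: (h (0, j)).
by move=> h; apply/bigmax_leP; split=> // -[i j] _ /=; rewrite ord1.
Qed.

(** The corners of the staircase path from [0] to [v] along the axes. *)
Definition stair m (v : 'rV[R]_m) (k : nat) : 'rV[R]_m :=
  \row_j (if (j < k)%N then v 0 j else 0).

Lemma stairS m (v : 'rV[R]_m) (k : 'I_m) :
  stair v k.+1 = v 0 k *: delta_mx 0 k + stair v k.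
Proof.
apply/rowP => j; rewrite !mxE eqxx /= ltnS leq_eqVlt.
have [->|jk] := eqVneq j k; first by rewrite !eqxx ltnn mulr1 addr0.
by rewrite (inj_eq val_inj) (negbTE jk) mulr0 add0r.
Qed.

Lemma MVT_dir m (F : 'rV[R]_m -> R) (a w : 'rV[R]_m) (s : R) :
  (forall t : R, `|t| <= `|s| -> derivable F (t *: w + a) w) ->
  exists2 t, `|t| <= `|s| & F (s *: w + a) - F a = 'D_w F (t *: w + a) * s.
Proof.
move=> dF; pose g t := F (t *: w + a).
have gE (t : R) : (fun h : R => h^-1 *: ((g \o shift t) (h *: (1 : R)) - g t)) =
    (fun h : R => h^-1 *: ((F \o shift (t *: w + a)) (h *: w) - F (t *: w + a))).
  apply/funext => h; rewrite /g /= scaler1 (_ : (h + t) *: w + a = h *: w + (t *: w + a)) //.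
  by rewrite scalerDl addrA.
have dg (t : R) : `|t| <= `|s| -> is_derive t 1 g ('D_w F (t *: w + a)).
  move=> ts; apply: DeriveDef; first by rewrite /derivable gE; exact: dF.
  by rewrite /derive gE.
have cg A : {in A, forall t, `|t| <= `|s|} -> {within A, continuous g}.
  move=> hA; apply: continuous_in_subspaceT => t /hA ts.
  by apply/differentiable_continuous/derivable1_diffP; case: (dg t ts).
have g0 : F a = g 0 by rewrite /g scale0r add0r.
have [s0|s0] := leP 0 s.
  have le t : t \in `[0, s] -> `|t| <= `|s|.
    by rewrite in_itv /= => /andP[t0 ts]; rewrite !ger0_norm.
  have [||t ts e] := @MVT_segment R g (fun t => 'D_w F (t *: w + a)) 0 s s0.
  - by move=> t /subset_itv_oo_cc /le; exact: dg.
  - by apply: cg => t /[!inE]; exact: le.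
  exists t; first exact: le.
  by rewrite g0 -[LHS]/(g s - g 0) e subr0.
have le t : t \in `[s, 0] -> `|t| <= `|s|.
  rewrite in_itv /= => /andP[t0 ts]; rewrite !ler0_norm //; last exact: ltW.
  by rewrite lerN2.
have [||t ts e] := @MVT_segment R g (fun t => 'D_w F (t *: w + a)) s 0 (ltW s0).
- by move=> t /subset_itv_oo_cc /le; exact: dg.
- by apply: cg => t /[!inE]; exact: le.
exists t; first exact: le.
by rewrite g0 -[LHS]/(g s - g 0) -opprB e sub0r mulrN opprK.
Qed.

(** The mean value theorem on each step of the staircase from [x] to [v + x];
    the steps stay in the closed ball because the norm is the sup norm. *)
Lemma MVT_partial m (F : 'rV[R]_m -> R) (x v : 'rV[R]_m) :
  (forall i y, `|y - x| <= `|v| -> derivable F y (delta_mx 0 i)) ->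
  exists2 xi : 'I_m -> 'rV[R]_m, forall j, `|xi j - x| <= `|v|
    & F (v + x) - F x = \sum_j 'D_(delta_mx 0 j) F (xi j) * v 0 j.
Proof.
move=> dF.
have step (j : 'I_m) : exists y : 'rV[R]_m, `|y - x| <= `|v| /\
    F (stair v j.+1 + x) - F (stair v j + x) = 'D_(delta_mx 0 j) F y * v 0 j.
  have near t : `|t| <= `|v 0 j| -> `|t *: delta_mx 0 j + (stair v j + x) - x| <= `|v|.
    move=> tv; rewrite addrA addrK; apply/mx_norm_le => // i; rewrite !mxE eqxx /=.
    have [->|ij] := eqVneq i j.
      rewrite ltnn mulr1 addr0; apply: le_trans tv _.
      exact: ((mx_norm_le v (normr_ge0 v)).1 (lexx _)).
    rewrite mulr0 add0r; case: ifP => _; last by rewrite normr0.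
    exact: ((mx_norm_le v (normr_ge0 v)).1 (lexx _)).
  have [|t tv e] := @MVT_dir m F (stair v j + x) (delta_mx 0 j) (v 0 j).
    by move=> t tv; apply/dF/near.
  exists (t *: delta_mx 0 j + (stair v j + x)); split; first exact: near.
  by rewrite -e stairS addrA.
have [xi hxi] := choice step; exists xi => [j|]; first by case: (hxi j).
under eq_bigr => j _ do rewrite -(hxi j).2.
rewrite -(big_mkord xpredT (fun j => F (stair v j.+1 + x) - F (stair v j + x))).
rewrite telescope_sumr //; congr (F (_ + _) - F _).
  by apply/rowP => j; rewrite mxE ltn_ord.
by rewrite (_ : stair v 0 = 0) ?add0r//; apply/rowP => j; rewrite !mxE.
Qed.

(** The candidate for the differential. *)
Definition grad m (F : 'rV[R]_m -> R) (x v : 'rV[R]_m) : R :=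
  \sum_j v 0 j * 'D_(delta_mx 0 j) F x.

Fact grad_linear m (F : 'rV[R]_m -> R) x : linear (grad F x).
Proof.
move=> c v w; rewrite /grad scaler_sumr -big_split /=; apply: eq_bigr => j _.
by rewrite !mxE mulrDl -mulrA.
Qed.

HB.instance Definition _ m F x := GRing.isLinear.Build R 'rV[R]_m R _ _ (@grad_linear m F x).

Lemma grad_continuous m (F : 'rV[R]_m -> R) x : continuous (grad F x).
Proof.
move=> v; rewrite /grad; apply: (cvg_big _ (F := nbhs v)) => [|j _]; first exact: add_continuous.
by apply: cvgM; [exact: coord_continuous|exact: cvg_cst].
Qed.

Lemma littleo_differentiable (V W : normedModType R) (f : V -> W)
    (df : {linear V -> W}) x :
  continuous df -> f \o shift x = cst (f x) + df +o_ 0 id ->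
  differentiable f x /\ 'd f x = df :> (V -> W).
Proof.
move=> cdf key; have dE := diff_unique cdf key; split=> //.
by apply/diff_locallyP; rewrite dE; split=> //; exact: key.
Qed.

(** By the mean value theorem on the staircase, the increment of [F] is a
    combination of partial derivatives at nearby points, which continuity
    replaces by those at [x]. *)
Lemma C1_differentiable m (F : 'rV[R]_m -> R) (x : 'rV[R]_m) :
  (forall i, \forall y \near x, derivable F y (delta_mx 0 i)) ->
  (forall i, {for x, continuous ('D_(delta_mx 0 i) F)}) ->
  differentiable F x /\ 'd F x = grad F x :> (_ -> _).
Proof.
move=> dF cF.
apply: littleo_differentiable; first exact: grad_continuous.
apply/eqaddoP => _/posnumP[e].
  (* The error is shared among [m] coordinates; [m.+1] also covers [m = 0]. *)
  have mp : 0 < (m.+1%:R)^-1 :> R by rewrite invr_gt0 ltr0n.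
  pose Q i y := derivable F y (delta_mx 0 i) /\
      `|'D_(delta_mx 0 i) F x - 'D_(delta_mx 0 i) F y| <= e%:num / m.+1%:R.
  have : \forall y \near x, forall i, Q i y.
    apply: (@filter_forall _ _ Q (nbhs x)) => i; apply: filterI; first exact: dF.
    have := cF i; move/cvgrPdist_le; apply; exact: mulr_gt0.
  move=> /nbhs_ballP[d /= d0 hd].
  near=> v.
  have vd : `|v| < d by near: v; apply: (@nbhs0_lt R 'rV[R]_m d d0).
  have inb y : `|y - x| <= `|v| -> ball x d y.
    by move=> h; rewrite -ball_normE /= distrC; exact: le_lt_trans vd.
  have [i y yv|xi hxi E] := @MVT_partial m F x v; first by case: (hd y (inb y yv) i).
  rewrite !fctE /= opprD addrA E /grad -sumrB.
  apply: (@le_trans _ _ (\sum_(j < m) e%:num / m.+1%:R * `|v|)).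
    apply: (le_trans (ler_norm_sum _ _ _)); apply: ler_sum => j _.
    rewrite mulrC -mulrBr normrM mulrC; apply: ler_pM => //.
      by rewrite distrC; case: (hd _ (inb _ (hxi j)) j).
    exact: ((mx_norm_le v (normr_ge0 v)).1 (lexx _)).
  rewrite sumr_const card_ord -[leLHS]mulr_natl mulrA; apply: ler_wpM2r => //.
  rewrite mulrCA -[leRHS]mulr1; apply: ler_wpM2l => //.
  by rewrite ler_pdivrMr ?ltr0n// mul1r ler_nat.
Unshelve. all: by end_near. Qed.

End DifferentialCalculus.

(** * The chain rule and composition of smooth functions *)

Section Composition.
Variable R : realType.

Lemma Ck_C1 m k (U : set 'rV[R]_m) F x : open U -> Ck k.+1 U F -> U x ->
  differentiable F x /\ 'd F x = grad F x :> (_ -> _).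
Proof.
move=> oU [_ dF hF] Ux; apply: C1_differentiable => i.
  by near=> y; apply: dF; near: y; exact: open_nbhs_nbhs.
exact: Ck_cont (hF i) Ux.
Unshelve. all: by end_near. Qed.

Lemma differentiable_row m (V : normedModType R) (G : 'I_m -> V -> R) x :
  (forall j, differentiable (G j) x) -> differentiable (fun y => \row_j G j y) x.
Proof.
move=> dG.
rewrite (_ : (fun y => _) = \sum_j (fun y => G j y *: (delta_mx 0 j : 'rV[R]_m))).
  by apply: differentiable_sum => j; apply: differentiableZl; exact: dG.
apply/funext => y; rewrite fct_sumE [LHS]row_sum_delta.
by apply: eq_bigr => j _; rewrite mxE.
Qed.

Lemma derive_comp_row m (V : normedModType R) (F : 'rV[R]_m -> R)
    (G : 'I_m -> V -> R) x v :
  differentiable F (\row_j G j x) -> 'd F (\row_j G j x) = grad F (\row_j G j x) :> (_ -> _) ->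
  (forall j, differentiable (G j) x) ->
  let H := fun y => F (\row_j G j y) in
  differentiable H x /\ 'D_v H x =
    \sum_j 'D_(delta_mx 0 j) F (\row_j G j x) * 'D_v (G j) x.
Proof.
move=> dF dFE dG; have dR := differentiable_row dG.
have dH : differentiable (F \o fun y => \row_j G j y) x by exact: differentiable_comp.
split; first exact: dH.
rewrite -[fun y => F _]/(F \o fun y => \row_j G j y) deriveE // diff_comp //=.
rewrite dFE -deriveE // derive_mx; last exact: diff_derivable.
rewrite /grad; apply: eq_bigr => j _; rewrite !mxE mulrC.
by rewrite (_ : (fun t => (\row_j G j t) 0 j) = G j) //; apply/funext => y; rewrite mxE.
Qed.

Lemma Ck_sum m k (U : set 'rV[R]_m) (I : Type) (r : seq I) (f : I -> 'rV[R]_m -> R) :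
  open U -> (forall i, Ck k U (f i)) -> Ck k U (fun x => \sum_(i <- r) f i x).
Proof.
move=> oU hf; elim: r => [|i r IH].
  by rewrite (_ : (fun x => _) = fun=> 0); [exact: Ck_cst|apply/funext => x; rewrite big_nil].
rewrite (_ : (fun x => _) = fun x => f i x + \sum_(j <- r) f j x); first exact: CkD.
by apply/funext => x; rewrite big_cons.
Qed.

Lemma Ck_prod m k (U : set 'rV[R]_m) (I : Type) (r : seq I) (f : I -> 'rV[R]_m -> R) :
  open U -> (forall i, Ck k U (f i)) -> Ck k U (fun x => \prod_(i <- r) f i x).
Proof.
move=> oU hf; elim: r => [|i r IH].
  by rewrite (_ : (fun x => _) = fun=> 1); [exact: Ck_cst|apply/funext => x; rewrite big_nil].
rewrite (_ : (fun x => _) = fun x => f i x * \prod_(j <- r) f j x); first exact: CkM.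
by apply/funext => x; rewrite big_cons.
Qed.

(** Induction on the order: by the chain rule a partial derivative of the
    composite is a sum of products of functions of order [k]. *)
Lemma Ck_comp m p k (U : set 'rV[R]_p) (V : set 'rV[R]_m) F (G : 'I_m -> 'rV[R]_p -> R) :
  open U -> open V -> (forall x, U x -> V (\row_j G j x)) ->
  Ck k V F -> (forall j, Ck k U (G j)) -> Ck k U (fun x => F (\row_j G j x)).
Proof.
move=> oU oV UV.
have cont (F' : 'rV[R]_m -> R) x : U x -> {for \row_j G j x, continuous F'} ->
    (forall j, {for x, continuous (G j)}) ->
    {for x, continuous (fun x => F' (\row_j G j x))}.
  move=> Ux cF cG.
  apply: (@continuous_comp _ 'rV[R]_m R (fun x => \row_j G j x) F'); last exact: cF.
  exact: continuous_row.
elim: k F => [|k IH] F hF hG.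
  by move=> x Ux; apply: cont => // [|j]; [exact/hF/UV|exact: hG].
have dF x : U x -> _ := fun Ux => Ck_C1 oV hF (UV x Ux).
have dG x j : U x -> _ := fun Ux => Ck_C1 oU (hG j) Ux.
have dH x i : U x -> _ := fun Ux => derive_comp_row (delta_mx 0 i : 'rV[R]_p)
  (dF x Ux).1 (dF x Ux).2 (fun j => (dG x j Ux).1).
split=> [x Ux|i x Ux|i].
- by apply: cont => // [|j]; [exact: Ck_cont hF (UV x Ux)|exact: Ck_cont (hG j) Ux].
- by apply: diff_derivable; case: (dH x i Ux).
- apply: (@Ck_eq _ _ _ _ (fun x => \sum_j 'D_(delta_mx 0 j) F (\row_j G j x) *
      'D_(delta_mx 0 i) (G j) x)) => //.
    by move=> x Ux; have [_ ->] := dH x i Ux.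
  apply: Ck_sum => // j; apply: CkM => //.
    by apply: (IH ('D_(delta_mx 0 j) F)) => [|l]; [case: hF => _ _; exact|exact: CkS].
  by case: (hG j) => _ _; exact.
Qed.

Lemma Ck_local m k (U : set 'rV[R]_m) F :
  (forall x, U x -> exists W, [/\ open W, W x & Ck k W F]) -> Ck k U F.
Proof.
elim: k F => [|k IH] F hF.
  by move=> x /hF [W [oW Wx hW]]; exact: Ck_cont hW Wx.
split=> [x /hF [W [oW Wx hW]]|i x /hF [W [oW Wx [_ dF _]]]|i].
- exact: Ck_cont hW Wx.
- exact: dF.
- by apply: IH => x /hF [W [oW Wx [_ _ hW]]]; exists W; split=> //; exact: hW.
Qed.

Lemma smooth_on_local m (U : set 'rV[R]_m) F :
  (forall x, U x -> Rn_smooth_at F x) -> smooth_on U F.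
Proof.
move=> h k; apply: Ck_local => x /h [W [[oW Wx] sF]].
by exists W.
Qed.

Lemma derive_coord m i j (x : 'rV[R]_m) :
  derivable (fun x : 'rV[R]_m => x 0 i : R) x (delta_mx 0 j) /\
  'D_(delta_mx 0 j) (fun x : 'rV[R]_m => x 0 i : R) x = (i == j)%:R.
Proof.
have d : derivable (id : 'rV[R]_m -> 'rV[R]_m) x (delta_mx 0 j) by exact: derivable_id.
have -> : (i == j)%:R = ('D_(delta_mx 0 j) (id : 'rV[R]_m -> 'rV[R]_m) x) 0 i :> R.
  by rewrite derive_id mxE eqxx.
by split; [exact: (derivable_mxP _ _ _).1 d 0 i|rewrite derive_mx // mxE].
Qed.

Lemma smooth_on_coord m (U : set 'rV[R]_m) i : smooth_on U (fun x => x 0 i).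
Proof.
case=> [|k]; first by move=> x _; exact: coord_continuous.
split=> [x _|j x _|j]; [exact: coord_continuous|by case: (derive_coord i j x)|].
rewrite (_ : 'D_(delta_mx 0 j) _ = fun=> (i == j)%:R :> R); first exact: Ck_cst.
by apply/funext => x; case: (derive_coord i j x).
Qed.

End Composition.

(** * Bump functions *)

Section BumpFunctions.
Variable R : realType.

(** The family [t^-m exp (- 1 / t)] extended by zero, and not only its member
    of index [0], because it is closed under differentiation up to linear
    combinations. *)
Definition flat (m : nat) (t : R) : R :=
  if 0 < t then t^-1 ^+ m * expR (- t^-1) else 0.

Lemma flat_ge0 m t : 0 <= flat m t.
Proof.
rewrite /flat; case: ifP => // t0.
by apply: mulr_ge0; [apply: exprn_ge0; rewrite invr_ge0 ltW|exact: expR_ge0].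
Qed.

Lemma flat_gt0 m t : 0 < t -> 0 < flat m t.
Proof.
move=> t0; rewrite /flat t0; apply: mulr_gt0; last exact: expR_gt0.
by apply: exprn_gt0; rewrite invr_gt0.
Qed.

Lemma flat_eq0 m t : t <= 0 -> flat m t = 0.
Proof. by rewrite /flat; case: ltP. Qed.

(** [exp (1 / t)] exceeds the single term [t^-(m+1) / (m+1)!] of its series. *)
Lemma flat_le m t : `|flat m t| <= (m.+1)`!%:R * `|t|.
Proof.
have [t0|t0] := ltP 0 t; last by rewrite flat_eq0 // normr0 mulr_ge0.
rewrite !ger0_norm ?flat_ge0 ?(ltW t0)// /flat t0 expRN.
rewrite ler_pdivrMr ?expR_gt0//.
have := @expR_ge1Dxn R (t^-1) m; rewrite invr_ge0 ltW // => /(_ isT) h.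
have {h} : t^-1 ^+ m.+1 / (m.+1)`!%:R <= expR t^-1 by apply: le_trans h; rewrite lerDr.
rewrite ler_pdivrMr ?ltr0n ?fact_gt0// => h.
rewrite mulrAC mulrC -ler_pdivrMl // (mulrC _%:R) (le_trans _ h) //.
by rewrite exprS.
Qed.

(** At [0] the difference quotient of [flat m] is [flat m.+1], which tends to
    [0] by [flat_le]. *)
Lemma flat_deriv m (t : R) : is_derive t 1 (flat m) (flat m.+2 t - m%:R * flat m.+1 t).
Proof.
have [t0|t0|t0] := ltgtP t 0.
- have n0 : \forall s \near t, (cst 0 : R -> R) s = flat m s.
    by near=> s; rewrite flat_eq0 // ltW //; near: s; exact: lt_nbhsl.
  have [d e] := near_eq_is_derive n0 (is_derive_cst (0 : R) t (1 : R)).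
  by rewrite !flat_eq0 ?ltW// mulr0 subrr; exact: DeriveDef.
- have n0 : \forall s \near t, s^-1 ^+ m * expR (- s^-1) = flat m s.
    by near=> s; rewrite /flat ifT //; near: s; exact: cvgr_gt t cvg_id _ t0.
  suff h : is_derive t 1 (fun s : R => s^-1 ^+ m * expR (- s^-1))
      (flat m.+2 t - m%:R * flat m.+1 t).
    exact: near_eq_is_derive n0 h.
  have tn0 : t != 0 by rewrite gt_eqF.
  have dV : is_derive t 1 (fun s : R => s^-1) (- (t^-1 ^+ 2)).
    apply: DeriveDef; first exact: (@derivableV R R id t 1 tn0 (@derivable_id _ _ t 1)).
    by rewrite (@deriveV R R id t 1 tn0 (@derivable_id _ _ t 1)) derive_id -exprVn [LHS]mulr1.
  have dX := is_deriveX m dV.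
  have dN : is_derive t 1 (fun s : R => - s^-1) (t^-1 ^+ 2).
    by apply: (is_derive_eq (is_deriveN dV)); rewrite opprK.
  have dE := @is_derive1_comp R expR (fun s : R => - s^-1) t _ _ (is_derive_expR (- t^-1)) dN.
  have -> : (fun s : R => s^-1 ^+ m * expR (- s^-1)) =
      ((fun s : R => s^-1) ^+ m) * (expR \o fun s : R => - s^-1).
    by apply/funext => s; rewrite -[RHS]/(((fun s : R => s^-1) ^+ m) s * expR (- s^-1)) exprfctE.
  apply: (is_derive_eq (is_deriveM dX dE)).
  rewrite exprfctE /= /flat t0 /GRing.scale /=.
  case: (m) => [|k]; first by rewrite !mul0r !mulr0 expr0; ring.
  by rewrite !exprS /=; ring.
- rewrite t0.
  rewrite [X in is_derive _ _ _ X](_ : _ = 0); last by rewrite !flat_eq0 // mulr0 subrr.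
  have q : (fun h : R => h^-1 *: ((flat m \o shift 0) (h *: (1 : R)) - flat m 0)) @ 0^'
      --> (0 : R).
    apply: (@cvg_trans _ (flat m.+1 @ 0^')).
      apply: near_eq_cvg; near=> h.
      have h0 : h != 0 by near: h; exact: nbhs_dnbhs_neq.
      rewrite /= scaler1 addr0 (flat_eq0 _ (lexx 0)) subr0 /flat.
      by case: ifP => _; rewrite ?scaler0// exprS -mulrA.
    apply/cvgrPdist_le => e e0; near=> h.
    rewrite sub0r normrN (le_trans (flat_le _ _)) //.
    rewrite -ler_pdivlMl ?ltr0n ?fact_gt0//.
    near: h; apply: dnbhs0_le; apply: mulr_gt0 => //.
  apply: DeriveDef; first by apply/cvg_ex; exists 0.
  exact: cvg_lim q.
Unshelve. all: by end_near. Qed.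

Lemma quotient_line (u : R -> R) (x : 'rV[R]_1) i :
  (fun h : R => h^-1 *: (((fun v : 'rV[R]_1 => u (v 0 0)) \o shift x) (h *: delta_mx 0 i)
     - u (x 0 0))) =
  (fun h : R => h^-1 *: ((u \o shift (x 0 0)) (h *: (1 : R)) - u (x 0 0))).
Proof. by apply/funext => h /=; rewrite !mxE (ord1 i) !eqxx. Qed.

(** Functions of one variable enter as functions on one-row vectors, so that
    [Ck_comp] applies to them. *)
Lemma derive_line (u : R -> R) (x : 'rV[R]_1) i d : is_derive (x 0 0) 1 u d ->
  derivable (fun v : 'rV[R]_1 => u (v 0 0)) x (delta_mx 0 i) /\
  'D_(delta_mx 0 i) (fun v : 'rV[R]_1 => u (v 0 0)) x = d.
Proof.
case=> du <-; split.
  by rewrite /derivable quotient_line; exact: du.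
by rewrite /derive quotient_line.
Qed.

Lemma continuous_line (u : R -> R) (x : 'rV[R]_1) :
  {for x 0 0, continuous u} -> {for x, continuous (fun v : 'rV[R]_1 => u (v 0 0))}.
Proof.
move=> cu; apply: (@continuous_comp _ R R (fun v : 'rV[R]_1 => v 0 0) u) => //.
exact: coord_continuous.
Qed.

Lemma smooth_flat m : smooth_on setT (fun v : 'rV[R]_1 => flat m (v 0 0)).
Proof.
have cont k (x : 'rV[R]_1) : {for x, continuous (fun v : 'rV[R]_1 => flat k (v 0 0))}.
  apply: continuous_line.
  by apply/differentiable_continuous/derivable1_diffP; case: (flat_deriv k (x 0 0)).
move=> k; elim: k m => [|k IH] m; first by move=> x _; exact: cont.
split=> [x _|i x _|i]; first exact: cont.
  by case: (@derive_line (flat m) x i _ (flat_deriv m _)).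
apply: (@Ck_eq _ _ _ _ (fun x : 'rV[R]_1 =>
  flat m.+2 (x 0 0) + - m%:R * flat m.+1 (x 0 0))); first exact: openT.
  by move=> x _; have [_ ->] := @derive_line (flat m) x i _ (flat_deriv m _); rewrite mulNr.
apply: CkD; [exact: openT|exact: IH|].
by apply: CkM; [exact: openT|exact: Ck_cst|exact: IH].
Qed.

Lemma open_neq0 : open [set v : 'rV[R]_1 | v 0 0 != 0].
Proof.
have -> : [set v : 'rV[R]_1 | v 0 0 != 0] = (fun v : 'rV[R]_1 => v 0 0) @^-1` [set t | t != 0].
  by [].
apply: open_comp; first by move=> v _; exact: coord_continuous.
rewrite openE => t /= t0; exact: open_nbhs_nbhs (conj (@open_neq R 0) t0).
Qed.

Lemma smooth_invr : smooth_on [set v : 'rV[R]_1 | v 0 0 != 0] (fun v : 'rV[R]_1 => (v 0 0)^-1).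
Proof.
have D (t : R) : t != 0 -> is_derive t 1 (fun s : R => s^-1) (- (t^-1 * t^-1)).
  move=> t0; apply: DeriveDef; first exact: (@derivableV R R id t 1 t0 (@derivable_id _ _ t 1)).
  by rewrite (@deriveV R R id t 1 t0 (@derivable_id _ _ t 1)) derive_id -exprVn [LHS]mulr1.
have cont (x : 'rV[R]_1) : x 0 0 != 0 -> {for x, continuous (fun v : 'rV[R]_1 => (v 0 0)^-1)}.
  move=> x0; apply: (@continuous_line (fun s => s^-1)).
  by apply/differentiable_continuous/derivable1_diffP; case: (D _ x0).
elim=> [|k IH]; first by move=> x; exact: cont.
split=> [x|i x x0|i]; first exact: cont.
  by case: (@derive_line (fun s => s^-1) x i _ (D _ x0)).
apply: (@Ck_eq _ _ _ _ (fun x : 'rV[R]_1 => -1 * ((x 0 0)^-1 * (x 0 0)^-1))).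
- exact: open_neq0.
- by move=> x x0; have [_ ->] := @derive_line (fun s => s^-1) x i _ (D _ x0); rewrite mulN1r.
apply: CkM; [exact: open_neq0|exact: Ck_cst|].
by apply: CkM => //; exact: open_neq0.
Qed.

Lemma Ck_comp1 p k (U : set 'rV[R]_p) (V : set 'rV[R]_1) (u : R -> R) (f : 'rV[R]_p -> R) :
  open U -> open V -> (forall x, U x -> V (\row__ f x)) ->
  Ck k V (fun v => u (v 0 0)) -> Ck k U f -> Ck k U (u \o f).
Proof.
move=> oU oV UV hu hf; have := Ck_comp oU oV UV hu (fun=> hf).
by rewrite (_ : (fun x => _) = u \o f) //; apply/funext => x; rewrite mxE.
Qed.

Lemma CkV p k (U : set 'rV[R]_p) (f : 'rV[R]_p -> R) : open U ->
  (forall x, U x -> f x != 0) -> Ck k U f -> Ck k U (fun x => (f x)^-1).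
Proof.
move=> oU f0 hf; apply: (@Ck_comp1 _ _ _ _ (fun t => t^-1) f oU open_neq0) => //.
  by move=> x Ux /=; rewrite mxE; exact: f0.
exact: smooth_invr.
Qed.

(** Equal to [1] for [`|t| <= 1] and to [0] for [`|t| >= 2]: the constants are
    the squares of these bounds, and the two terms of the denominator are never
    zero together. *)
Definition plateau (t : R) : R :=
  flat 0 (4 - t * t) / (flat 0 (4 - t * t) + flat 0 (t * t - 1)).

Let plateau_den t : 0 < flat 0 (4 - t * t) + flat 0 (t * t - 1).
Proof.
have [t2|t2] := ltP (t * t) 4.
  by apply: ltr_pwDl; [apply: flat_gt0; lra|exact: flat_ge0].
by apply: ltr_wpDl; [exact: flat_ge0|apply: flat_gt0; lra].
Qed.

Lemma plateau_ge0 t : 0 <= plateau t.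
Proof. by apply: divr_ge0; [exact: flat_ge0|exact: ltW (plateau_den t)]. Qed.

Lemma plateau_le1 t : plateau t <= 1.
Proof. by rewrite ler_pdivrMr // mul1r lerDl flat_ge0. Qed.

Lemma plateau_eq1 t : `|t| <= 1 -> plateau t = 1.
Proof.
move=> t1; rewrite /plateau (@flat_eq0 0 (t * t - 1)).
  rewrite addr0 divff //; move: (plateau_den t); rewrite (@flat_eq0 0 (t * t - 1)) ?addr0.
    by move/gt_eqF => ->.
  by move: t1; rewrite ler_norml => /andP[? ?]; nra.
by move: t1; rewrite ler_norml => /andP[? ?]; nra.
Qed.

Lemma plateau_supp t : plateau t != 0 -> `|t| < 2.
Proof.
apply: contraNlt => t2; rewrite /plateau flat_eq0 ?mul0r//.
suff : 2 * 2 <= `|t| * `|t| by rewrite -normrM ger0_norm -?expr2 ?sqr_ge0//; lra.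
by apply: ler_pM.
Qed.

Lemma Ck_plateau p k (U : set 'rV[R]_p) f : open U -> Ck k U f ->
  Ck k U (fun x => plateau (f x)).
Proof.
move=> oU hf.
have flatC (g : 'rV[R]_p -> R) : Ck k U g -> Ck k U (fun x => flat 0 (g x)).
  move=> hg; apply: (@Ck_comp1 _ _ _ setT (flat 0) g oU openT) => //.
  exact: smooth_flat.
have f2 : Ck k U (fun x => f x * f x) by exact: CkM.
have h4 : Ck k U (fun x => flat 0 (4 - f x * f x)).
  apply: flatC; apply: (@Ck_eq _ _ _ _ (fun x => 4 + -1 * (f x * f x))) => //.
    by move=> x _; rewrite mulN1r.
  by apply: CkD => //; [exact: Ck_cst|apply: CkM => //; exact: Ck_cst].
apply: CkM => //; apply: CkV => // [x _|]; first by rewrite gt_eqF.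
apply: CkD => //; apply: flatC; apply: CkD => //; exact: Ck_cst.
Qed.

(** A product of one-variable plateaus, since the balls of the sup norm are
    cubes. *)
Lemma bump_exists n (y : 'rV[R]_n) (r : R) : 0 < r ->
  exists b : 'rV[R]_n -> R, [/\ smooth_on setT b, forall x, 0 <= b x <= 1,
    forall x, `|x - y| <= r -> b x = 1 & forall x, b x != 0 -> `|x - y| < 2 * r].
Proof.
move=> r0; have rV : `|r^-1| = r^-1 by rewrite ger0_norm // invr_ge0 ltW.
exists (fun x => \prod_i plateau ((x 0 i - y 0 i) * r^-1)); split.
- move=> k; apply: Ck_prod => [|i]; first exact: openT.
  apply: Ck_plateau; first exact: openT.
  apply: CkM; [exact: openT| |exact: Ck_cst].
  by apply: CkD; [exact: openT|exact: smooth_on_coord|exact: Ck_cst].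
- move=> x; elim/big_ind: _ => [|a b /andP[a0 a1] /andP[b0 b1]|i _].
  + by rewrite ler01 lexx.
  + by rewrite mulr_ge0 //= mulr_ile1.
  + by rewrite plateau_ge0 plateau_le1.
- move=> x xy; apply: big1 => i _; apply: plateau_eq1.
  rewrite normrM rV ler_pdivrMr // mul1r.
  by have := (mx_norm_le _ (ltW r0)).1 xy i; rewrite !mxE.
- move=> x; rewrite prodf_seq_neq0 => /allP h.
  suff : forall i, `|(x - y) 0 i| < 2 * r.
    move=> {}h; rewrite [`|_|]/Num.norm /= mx_normrE; apply/bigmax_ltP; split.
      exact: mulr_gt0.
    by move=> [i j] _ /=; rewrite ord1.
  move=> i; have /plateau_supp := h i (mem_index_enum i); rewrite !mxE.
  by rewrite normrM rV ltr_pdivrMr.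
Qed.

End BumpFunctions.

(** * Integration over the unit interval *)

Section UnitIntegral.
Variable R : realType.
Implicit Types f g F : R -> R.

Definition int01 f : R := Rintegral (@lebesgue_measure R) `[0, 1] f.

Lemma int01_integrable f : continuous f ->
  (@lebesgue_measure R).-integrable `[0, 1] (EFin \o f).
Proof.
move=> cf; apply: continuous_compact_integrable; first exact: segment_compact.
exact: continuous_subspaceT.
Qed.

Let m01 : measurable (`[0, 1]%classic : set (measurableTypeR R)).
Proof. exact: measurable_itv. Qed.

Lemma int01D f g : continuous f -> continuous g ->
  int01 (fun t => f t + g t) = int01 f + int01 g.
Proof. by move=> cf cg; apply: RintegralD => //; exact: int01_integrable. Qed.

Lemma int01B f g : continuous f -> continuous g ->
  int01 (fun t => f t - g t) = int01 f - int01 g.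
Proof. by move=> cf cg; apply: RintegralB => //; exact: int01_integrable. Qed.

Lemma int01Z c f : continuous f -> int01 (fun t => c * f t) = c * int01 f.
Proof. by move=> cf; apply: RintegralZl => //; exact: int01_integrable. Qed.

Lemma int01_cst c : int01 (fun=> c) = c.
Proof.
rewrite /int01 Rintegral_cst //= lebesgue_measure_itv /= lte_fin ltr01.
by rewrite -EFinB /= subr0 mulr1.
Qed.

Lemma int01_le f c : continuous f -> (forall t, t \in `[0, 1] -> `|f t| <= c) ->
  `|int01 f| <= c.
Proof.
move=> cf fc; have cn : continuous (fun t => `|f t|).
  by move=> t; apply: cvg_norm; exact: cf.
apply: le_trans (le_normr_Rintegral _ _) _ => //; first exact: int01_integrable.
rewrite -[leRHS](int01_cst c); apply: le_Rintegral => //.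
- exact: int01_integrable.
- by apply: (@int01_integrable (fun=> c)) => t; exact: cvg_cst.
Qed.

Lemma int01_FTC f F : continuous f -> (forall t : R, is_derive t 1 F (f t)) ->
  int01 f = F 1 - F 0.
Proof.
move=> cf dF.
have cF : continuous F.
  by move=> t; apply/differentiable_continuous/derivable1_diffP; case: (dF t).
rewrite /int01 /Rintegral (@continuous_FTC2 R f F 0 1) //.
- exact: continuous_subspaceT.
- split=> [t _||]; first by case: (dF t).
  + exact: cvg_at_right_filter (cF 0).
  + exact: cvg_at_left_filter (cF 1).
- by move=> t _; rewrite derive1E; case: (dF t).
Qed.

Lemma int01_sum m (f : 'I_m -> R -> R) : (forall i, continuous (f i)) ->
  int01 (fun t => \sum_i f i t) = \sum_i int01 (f i).
Proof.
move=> cf; elim: m f cf => [|m IH] f cf.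
  by rewrite big_ord0; under eq_fun do rewrite big_ord0; exact: int01_cst.
rewrite big_ord_recl -IH // -int01D //.
  by congr int01; apply/funext => t; rewrite big_ord_recl.
move=> t; apply: (cvg_big _ (F := nbhs t)) => [|i _]; first exact: add_continuous.
exact: cf.
Qed.

(** Compactness of the unit interval makes the continuity uniform in [t]. *)
Lemma uniform01 (W : topologicalType) (Phi : R -> W -> R) (w0 : W) (e : R) : 0 < e ->
  (forall t, {for (t, w0), continuous (fun z : R * W => Phi z.1 z.2)}) ->
  \forall w \near w0, forall t, t \in `[0, 1] -> `|Phi t w - Phi t w0| <= e.
Proof.
move=> e0 cPhi.
have K : compact (`[0, 1]%classic : set R) by exact: segment_compact.
have H := (compact_near_coveringP _).1 K W (nbhs w0)
  (fun w t => `|Phi t w - Phi t w0| <= e) (nbhs_filter w0).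
suff /H : forall t : R, `[0, 1]%classic t ->
    \forall t' \near t & w \near w0, `|Phi t' w - Phi t' w0| <= e.
  by apply: filterS => w h t t01; exact: h.
move=> t _.
have e2 : 0 < e / 2 by lra.
have [/= [P Q] [/= nP nQ] PQ] := (cvgrPdist_le _ _).1 (cPhi t) _ e2.
exists (P, Q) => //= -[s w] [/= Ps Qw].
have h1 := PQ (s, w) (conj Ps Qw).
have h2 := PQ (s, w0) (conj Ps (nbhs_singleton nQ)).
rewrite /= in h1 h2.
have -> : Phi s w - Phi s w0 = (Phi t w0 - Phi s w0) - (Phi t w0 - Phi s w) by ring.
by apply: le_trans (ler_normB _ _) _; lra.
Qed.

End UnitIntegral.

(** * Hadamard's lemma *)

Section Hadamard.
Variables (R : realType) (n : nat) (y : 'rV[R]_n).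
Implicit Types (g : 'rV[R]_n -> R) (x : 'rV[R]_n) (m : nat).

Definition segm (t : R) x : 'rV[R]_n := y + t *: (x - y).

(** The power of [t] is needed because each differentiation with respect to
    [x] brings out one more factor [t]. *)
Definition mean m g x : R := int01 (fun t => t ^+ m * g (segm t x)).

Lemma segm_continuous2 : continuous (fun z : R * 'rV[R]_n => segm z.1 z.2).
Proof.
move=> z; apply: cvgD; first exact: cvg_cst.
apply: (@cvgZ _ _ _ _ _); first exact: cvg_fst.
by apply: cvgB; [exact: cvg_snd|exact: cvg_cst].
Qed.

Lemma segm_continuous x : continuous (segm ^~ x).
Proof.
move=> t; apply: cvgD; first exact: cvg_cst.
by apply: (@cvgZ _ _ _ _ _); [exact: cvg_id|exact: cvg_cst].
Qed.

Lemma mean_integrand_continuous m g x : continuous g ->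
  continuous (fun t : R => t ^+ m * g (segm t x)).
Proof.
move=> cg t; apply: cvgM; first exact: exprn_continuous.
by apply: (@continuous_comp R _ R (segm ^~ x) g); [exact: segm_continuous|exact: cg].
Qed.

Let pow01 m (t : R) : t \in `[0, 1] -> `|t ^+ m| <= 1.
Proof. by rewrite in_itv /= normrX => /andP[t0 t1]; rewrite ger0_norm // exprn_ile1. Qed.

Lemma mean_continuous m g : continuous g -> continuous (mean m g).
Proof.
move=> cg x; apply/(@cvgrPdist_le _ _ _ (nbhs x)) => e e0.
have U := @uniform01 R _ (fun t x => g (segm t x)) x e e0.
suff /U : forall t : R, {for (t, x), continuous (fun z : R * 'rV[R]_n => g (segm z.1 z.2))}; last first.
  move=> t; apply: (@continuous_comp _ _ R (fun z : R * 'rV[R]_n => segm z.1 z.2) g).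
    exact: segm_continuous2.
  exact: cg.
move=> N; apply: (@filterS _ (nbhs x) (nbhs_filter x) _ _ _ N) => x' hx'; rewrite /= distrC /mean -int01B; try exact: mean_integrand_continuous.
apply: int01_le => [t|t t01].
  by apply: cvgB; exact: mean_integrand_continuous.
rewrite -mulrBr normrM -[leRHS]mul1r; apply: ler_pM => //; [exact: pow01|exact: hx'].
Qed.

Lemma segm_shift t x h (i : 'I_n) :
  segm t (h *: delta_mx 0 i + x) = (h * t) *: delta_mx 0 i + segm t x.
Proof.
by rewrite /segm addrCA -addrA scalerDr scalerA mulrC.
Qed.

(** Differentiation under the integral sign: the mean value theorem writes the
    difference quotient as a partial derivative of [g] at a point which tends
    to [segm t x], uniformly in [t]. *)
Lemma mean_derive m g i x : continuous g -> continuous ('D_(delta_mx 0 i) g) ->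
  (forall x, derivable g x (delta_mx 0 i)) ->
  derivable (mean m g) x (delta_mx 0 i) /\
  'D_(delta_mx 0 i) (mean m g) x = mean m.+1 ('D_(delta_mx 0 i) g) x.
Proof.
move=> cg cdg dg.
suff q : h^-1 *: ((mean m g \o shift x) (h *: delta_mx 0 i) - mean m g x) @[h --> 0^']
    --> mean m.+1 ('D_(delta_mx 0 i) g) x.
  by split; [apply/cvg_ex; eexists; exact: q|exact: cvg_lim q].
apply/cvgrPdist_le => e e0.
pose Phi (t s : R) := 'D_(delta_mx 0 i) g (s *: delta_mx 0 i + segm t x).
have /nbhs_ballP[d /= d0 hd] :
    \forall s \near (0 : R), forall t : R, t \in `[0, 1] -> `|Phi t s - Phi t 0| <= e.
  apply: uniform01 => // t.
  apply: (@continuous_comp _ _ _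
    (fun z : R * R => z.2 *: delta_mx 0 i + segm z.1 x) ('D_(delta_mx 0 i) g)); last exact: cdg.
  apply: cvgD; first by apply: cvgZ; [exact: cvg_snd|exact: cvg_cst].
  apply: (@continuous_comp _ _ _ fst (segm ^~ x)); first exact: cvg_fst.
  exact: segm_continuous.
near=> h.
have h0 : h != 0 by near: h; exact: nbhs_dnbhs_neq.
have hd' : `|h| < d by near: h; exact: dnbhs0_lt.
have ci k x' : continuous (fun t : R => t ^+ k * g (segm t x')).
  exact: mean_integrand_continuous.
have cdi k x' : continuous (fun t : R => t ^+ k * 'D_(delta_mx 0 i) g (segm t x')).
  exact: (@mean_integrand_continuous k ('D_(delta_mx 0 i) g) x' cdg).
rewrite /= distrC /mean -int01B // /GRing.scale /= -int01Z; last first.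
  by move=> t; apply: cvgB; exact: ci.
rewrite -int01B; last 2 first.
- by move=> t; apply: cvgM; [exact: cvg_cst|apply: cvgB; exact: ci].
- exact: cdi.
apply: int01_le => [t|t t01].
  apply: cvgB; last exact: cdi.
  by apply: cvgM; [exact: cvg_cst|apply: cvgB; exact: ci].
rewrite segm_shift.
have [s st E] := @MVT_dir R n g (segm t x) (delta_mx 0 i) (h * t) (fun _ _ => dg _).
have -> : h^-1 * (t ^+ m * g ((h * t) *: delta_mx 0 i + segm t x) - t ^+ m * g (segm t x)) -
    t ^+ m.+1 * 'D_(delta_mx 0 i) g (segm t x) =
    t ^+ m.+1 * ('D_(delta_mx 0 i) g (s *: delta_mx 0 i + segm t x) -
      'D_(delta_mx 0 i) g (0 *: delta_mx 0 i + segm t x)).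
  by rewrite -[X in h^-1 * X]mulrBr E scale0r add0r exprS; field.
rewrite normrM -[leRHS]mul1r; apply: ler_pM => //; first exact: pow01.
apply: hd => //; rewrite -ball_normE /= sub0r normrN; apply: le_lt_trans st _.
rewrite normrM; apply: le_lt_trans hd'; rewrite -[leRHS]mulr1; apply: ler_wpM2l => //.
by rewrite -[t]expr1; exact: pow01.
Unshelve. all: by end_near. Qed.

Lemma smooth_on_continuous g : smooth_on setT g -> continuous g.
Proof. by move=> sg x; exact: Ck_cont (sg 0) Logic.I. Qed.

Lemma smooth_on_derive g i : smooth_on setT g -> smooth_on setT ('D_(delta_mx 0 i) g).
Proof. by move=> sg k; have [_ _] := sg k.+1; exact. Qed.

Lemma smooth_mean m g : smooth_on setT g -> smooth_on setT (mean m g).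
Proof.
move=> sg k; elim: k m g sg => [|k IH] m g sg.
  by move=> x _; apply: mean_continuous; exact: smooth_on_continuous.
have D i x := @mean_derive m g i x (smooth_on_continuous sg)
  (smooth_on_continuous (smooth_on_derive i sg)) (fun x => let: And3 _ d _ := sg 1 in d i x Logic.I).
split=> [x _|i x _|i]; first by apply: mean_continuous; exact: smooth_on_continuous.
  by case: (D i x).
rewrite (_ : 'D_(delta_mx 0 i) _ = mean m.+1 ('D_(delta_mx 0 i) g)).
  by apply: IH; exact: smooth_on_derive.
by apply/funext => x; case: (D i x).
Qed.

(** The derivative of [g] along the segment from [y] to [x] is integrated; the
    quotients [h i] are means of partial derivatives, hence smooth. *)
Lemma hadamard g : smooth_on setT g ->
  exists2 h : 'I_n -> 'rV[R]_n -> R, forall i, smooth_on setT (h i)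
    & forall x, g x = g y + \sum_i (x 0 i - y 0 i) * h i x.
Proof.
move=> sg; exists (fun i => mean 0 ('D_(delta_mx 0 i) g)) => [i|x].
  by apply: smooth_mean; exact: smooth_on_derive.
have cdg i : continuous (fun t => 'D_(delta_mx 0 i) g (segm t x)).
  move=> t; apply: (@continuous_comp R _ R (segm ^~ x) ('D_(delta_mx 0 i) g)).
    exact: segm_continuous.
  exact: smooth_on_continuous (smooth_on_derive i sg) _.
have cs i : continuous (fun t => (x 0 i - y 0 i) * 'D_(delta_mx 0 i) g (segm t x)).
  by move=> t; apply: cvgM; [exact: cvg_cst|exact: cdg].
have dF (t : R) : is_derive t 1 (fun t => g (segm t x))
    (\sum_i (x 0 i - y 0 i) * 'D_(delta_mx 0 i) g (segm t x)).
  pose G i (t : R) := y 0 i + t * (x 0 i - y 0 i).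
  have dG i (s : R) : is_derive s 1 (G i) (x 0 i - y 0 i).
    have -> : G i = cst (y 0 i) + (x 0 i - y 0 i) *: (id : R -> R).
      by apply/funext => u; rewrite /G mulrC.
    have := is_deriveD (is_derive_cst (y 0 i) s 1) (is_deriveZ (x 0 i - y 0 i) (is_derive_id s 1)).
    by move=> d; apply: (is_derive_eq d); rewrite add0r [LHS]mulr1.
  have GE s : \row_i G i s = segm s x by apply/rowP => i; rewrite !mxE.
  have [dg dgE] := @Ck_C1 R n 0 setT g (segm t x) openT (sg 1) Logic.I.
  rewrite -GE in dg dgE.
  have [d e] := @derive_comp_row R n R g G t 1 dg dgE
    (fun j => (derivable1_diffP _ _).1 (@ex_derive _ _ _ _ _ _ _ (dG j t))).
  rewrite (_ : (fun t => g (segm t x)) = fun t => g (\row_i G i t)); last first.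
    by apply/funext => s; rewrite GE.
  apply: DeriveDef; first exact/derivable1_diffP.
  rewrite e; apply: eq_bigr => i _; rewrite GE mulrC; congr (_ * _).
  by case: (dG i t).
have := int01_FTC _ dF; rewrite int01_sum // => E.
have {E} : \sum_i int01 (fun t => (x 0 i - y 0 i) * 'D_(delta_mx 0 i) g (segm t x)) =
    g (segm 1 x) - g (segm 0 x).
  apply: E => t; apply: (cvg_big _ (F := nbhs t)) => [|i _]; first exact: add_continuous.
  exact: cs.
rewrite /segm scale1r scale0r addr0 (addrC y) subrK => E.
rewrite addrC -[LHS](subrK (g y)) -E; congr (_ + _); apply: eq_bigr => i _.
rewrite int01Z //; congr (_ * int01 _).
by apply/funext => t; rewrite expr0 mul1r.
Qed.

End Hadamard.

(** * Germs of smooth functions *)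

Section SmoothGerms.
Variable R : realType.

Lemma dist_continuous m (y : 'rV[R]_m) : continuous (fun z : 'rV[R]_m => `|z - y|).
Proof.
have c : continuous (fun z : 'rV[R]_m => z - y).
  move=> z; exact: (@cvgB R 'rV[R]_m _ (nbhs z) _ id (fun=> y) z y cvg_id (cvg_cst _)).
move=> z; apply: (@continuous_comp _ _ R (fun z : 'rV[R]_m => z - y) Num.norm); first exact: c.
exact: norm_continuous.
Qed.

Lemma open_far m (y : 'rV[R]_m) (r : R) : open [set z : 'rV[R]_m | r < `|z - y|].
Proof. by apply: open_comp (@open_gt R r) => z _; exact: dist_continuous. Qed.

Lemma closed_near m (y : 'rV[R]_m) (r : R) : closed [set z : 'rV[R]_m | `|z - y| <= r].
Proof. by apply: closed_comp (@closed_le R r) => z _; exact: dist_continuous. Qed.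

Lemma Rn_smooth_global m (F : 'rV[R]_m -> R) x : smooth_on setT F -> Rn_smooth_at F x.
Proof. by move=> sF; exists setT; split=> //; exact: open_nbhsT. Qed.

Lemma Rn_smooth_comp m p (F : 'rV[R]_m -> R) (G : 'I_m -> 'rV[R]_p -> R) x :
  Rn_smooth_at F (\row_j G j x) -> (forall j, Rn_smooth_at (G j) x) ->
  Rn_smooth_at (fun y => F (\row_j G j y)) x.
Proof.
move=> [V [[oV Vx] sF]] sG.
have [U hU] := choice sG.
pose W := [set y | (forall j, U j y) /\ V (\row_j G j y)].
have oW : open W.
  rewrite openE => y [Uy Vy].
  have N1 : \forall z \near y, forall j, U j z.
    apply: (@filter_forall _ _ U (nbhs y)) => j.
    by apply: open_nbhs_nbhs; split; [case: (hU j) => [[]]|exact: Uy].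
  have N2 : \forall z \near y, V (\row_j G j z).
    have : {for y, continuous (fun z => \row_j G j z)}.
      by apply: continuous_row => j; have [_ s] := hU j; exact: Ck_cont (s 0) (Uy j).
    by apply; exact: open_nbhs_nbhs.
  by apply: filterS2 N1 N2 => z h1 h2.
exists W; split; first by split=> //; split=> // j; case: (hU j) => [[]].
move=> k; apply: (Ck_comp oW oV) => [y [_ h]||j]; [exact: h|exact: sF|].
apply: CkW ((hU j).2 k) => y [Uy _]; exact: Uy.
Qed.

Lemma Rn_smoothV m (F : 'rV[R]_m -> R) x : Rn_smooth_at F x -> F x != 0 ->
  Rn_smooth_at (fun y => (F y)^-1) x.
Proof.
move=> sF F0.
have sI : Rn_smooth_at (fun v : 'rV[R]_1 => (v 0 0)^-1) (\row__ F x).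
  exists [set v : 'rV[R]_1 | v 0 0 != 0]; split; last exact: smooth_invr.
  by split; [exact: open_neq0|rewrite /= mxE].
have := Rn_smooth_comp sI (fun=> sF); apply: Rn_smooth_near.
by apply: (near_open openT) => // y _; rewrite mxE.
Qed.

(** Multiplication by a bump function.  It reconciles composites, which are
    known to be smooth near a point only, with the definition of initial
    spaces, which asks for functions smooth on the whole space. *)
Lemma Rn_smooth_extend m (F : 'rV[R]_m -> R) x : Rn_smooth_at F x ->
  exists2 F', smooth_on setT F' & \forall y \near x, F y = F' y.
Proof.
move=> [U [[oU Ux] sF]].
have /nbhs_ballP[e /= e0 eU] := open_nbhs_nbhs (conj oU Ux).
have r0 : 0 < e / 4 by lra.
have [b [sb _ b1 bs]] := bump_exists x r0.
(* The bump is supported in the ball of radius [2 (e / 4)], inside [U]. *)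
exists (fun y => b y * F y).
  apply: smooth_on_local => y _.
  have [Uy|nUy] := pselect (U y).
    by exists U; split=> // k; apply: CkM => //; apply: CkW (sb k).
  pose W := [set z : 'rV[R]_m | 2 * (e / 4) < `|z - x|].
  exists W; split.
    split.
      exact: open_far.
    rewrite /W /= ltNge; apply/negP => h; apply: nUy; apply: eU.
    by rewrite -ball_normE /= distrC; lra.
  move=> k; apply: (@Ck_eq R m k W (fun=> 0)); last exact: Ck_cst.
    exact: open_far.
  move=> z Wz; have [->|/bs] := eqVneq (b z) 0; first by rewrite mul0r.
  by move: Wz; rewrite /W /= => h1 h2; lra.
apply/nbhs_ballP; exists (e / 4) => //= y; rewrite -ball_normE /= distrC => yx.
by rewrite b1 ?mul1r// ltW.
Qed.

End SmoothGerms.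

(** * Transport of smooth functions along a chart *)

Section SmoothFunctionsOnManifold.
Variables (R : realType) (n : nat) (M : manifold R n).
Implicit Types f g : smooth_fun M.

Lemma smooth_funP f z : smooth_at f z.
Proof. by case: f => f sf; have /asboolP := sf; exact. Qed.

Definition mk_smooth (f : M -> R) (h : forall z, smooth_at f z) : smooth_fun M :=
  SmoothFun (asboolT h).

Lemma smooth_eqP f g : (forall z, f z = g z) <-> f = g.
Proof. by split=> [fg|-> //]; apply/val_inj/funext. Qed.

Lemma sfD f g z : (f + g) z = f z + g z. Proof. by []. Qed.
Lemma sfB f g z : (f - g) z = f z - g z. Proof. by []. Qed.
Lemma sfM f g z : (f * g) z = f z * g z. Proof. by []. Qed.
Lemma sfZ c f z : (c *: f) z = c * f z. Proof. by []. Qed.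
Lemma sf1 z : (1 : smooth_fun M) z = 1. Proof. by []. Qed.
Lemma sf0 z : (0 : smooth_fun M) z = 0. Proof. by []. Qed.
Lemma sfA c z : (c%:A : smooth_fun M) z = c. Proof. by rewrite sfZ sf1 mulr1. Qed.
Lemma sf_sum (I : Type) (r : seq I) (F : I -> smooth_fun M) z :
  (\sum_(i <- r) F i) z = \sum_(i <- r) F i z.
Proof.
by elim: r => [|i r IH]; rewrite ?big_nil ?big_cons ?sf0 // sfD IH.
Qed.

Section Chart.
Variables (U : set M) (V : set 'rV[R]_n) (u : M -> 'rV[R]_n) (v : 'rV[R]_n -> M).
Hypothesis uv : @diffeo_on R M (euclidean R n) U V u v.

Let oU : open U. Proof. by case: uv => [[]]. Qed.
Let Vu z : U z -> V (u z). Proof. by case: uv => _ h _ _ _ /h []. Qed.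
Let uK z : U z -> v (u z) = z. Proof. by case: uv => _ h _ _ _ /h []. Qed.
Let Uv x : V x -> U (v x). Proof. by case: uv => _ _ h _ _ /h []. Qed.

Lemma chart_smooth (g : 'rV[R]_n -> R) z : U z -> Rn_smooth_at g (u z) -> smooth_at (g \o u) z.
Proof. by case: uv => _ _ _ h _ /h [_]; apply. Qed.

Lemma chart_pull (f : M -> R) x : V x -> smooth_at f (v x) -> Rn_smooth_at (f \o v) x.
Proof. by case: uv => _ _ _ _ h /h [_]; apply. Qed.

Lemma chart_near z (P : set M) : U z -> (\forall x \near u z, V x -> P (v x)) ->
  \forall w \near z, P w.
Proof.
move=> Uz nP; have cu : {for z, continuous (u : M -> euclidean R n)}.
  by case: uv => _ _ _ h _; case: (h z Uz).
have N := cu _ nP; near=> w.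
have Uw : U w by near: w; exact: open_nbhs_nbhs.
by rewrite -(uK Uw); have : V (u w) := Vu Uw; near: w; exact: N.
Unshelve. all: by end_near. Qed.

Variables (y0 : 'rV[R]_n) (rho : R).
Hypothesis KV : forall x, `|x - y0| <= rho -> V x.

Lemma closed_ball_far x : ~ (`|x - y0| <= rho) ->
  \forall y \near x, ~ (`|y - y0| <= rho).
Proof.
move=> h; have {}h : rho < `|x - y0| by rewrite ltNge; apply/negP.
have o := @open_far R n y0 rho.
have := open_nbhs_nbhs (conj o h); apply: (@filterS _ (nbhs x)) => y /= yr.
by apply/negP; rewrite -ltNge.
Qed.

(** Compact sets are closed because the manifold is Hausdorff; this makes the
    extensions by zero below smooth outside the chart. *)
Lemma compact_image_closed : closed (v @` [set x | `|x - y0| <= rho]).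
Proof.
apply: compact_closed; first exact: manifold_hausdorff.
apply: continuous_compact.
  apply: continuous_in_subspaceT => x; rewrite inE => /= /KV Vx.
  by case: uv => _ _ _ _ h; case: (h x Vx).
apply: bounded_closed_compact.
  exists (`|y0| + rho); split; first exact: num_real.
  move=> r rr x /= xr; rewrite -(subrK y0 x).
  by apply: le_trans (ler_normD _ _) _; lra.
exact: closed_near.
Qed.

Definition push_fun (phi : 'rV[R]_n -> R) (z : M) : R :=
  if `[< U z >] then phi (u z) else 0.

Lemma push_funE phi z : U z -> push_fun phi z = phi (u z).
Proof. by rewrite /push_fun => Uz; case: asboolP. Qed.

Lemma push_smooth phi : smooth_on setT phi -> (forall x, phi x != 0 -> `|x - y0| <= rho) ->
  forall z, smooth_at (push_fun phi) z.
Proof.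
move=> sphi supp z; have [Uz|nUz] := pselect (U z).
  apply: smooth_near (chart_smooth Uz (Rn_smooth_global (u z) sphi)).
  near=> w; rewrite push_funE //; near: w; exact: open_nbhs_nbhs.
apply: smooth_near (smooth_cst 0 z).
have oC : open (~` (v @` [set x | `|x - y0| <= rho])).
  by rewrite openC; exact: compact_image_closed.
have : nbhs z (~` (v @` [set x | `|x - y0| <= rho])).
  by apply: open_nbhs_nbhs; split=> // -[x /KV Vx xz]; apply: nUz; rewrite -xz; exact: Uv.
apply: filterS => w nw; rewrite /push_fun; case: asboolP => // Uw.
apply/eqP; rewrite eq_sym; apply/negPn/negP => /supp h; apply: nw.
by exists (u w) => //; exact: uK.
Unshelve. all: by end_near. Qed.

Lemma pull_smooth chi f : smooth_on setT chi -> (forall x, chi x != 0 -> `|x - y0| <= rho) ->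
  smooth_on setT (fun x => chi x * f (v x)).
Proof.
move=> schi supp; apply: smooth_on_local => x _.
have [Vx|nVx] := pselect (V x).
  apply: (Rn_smooth2 (@CkM R n) (f := chi) (g := f \o v)).
    exact: Rn_smooth_global.
  by apply: chart_pull => //; exact: smooth_funP.
have nx : ~ (`|x - y0| <= rho) by move/KV.
apply: Rn_smooth_near (Rn_smooth_cst 0 x).
apply: (@filterS _ (nbhs x) (nbhs_filter x) _ _ _ (closed_ball_far nx)) => y ny.
have [->|/supp //] := eqVneq (chi y) 0; by rewrite mul0r.
Qed.

End Chart.

End SmoothFunctionsOnManifold.

(** * Local coordinates made of global functions *)

Section LocalCoordinates.
Variables (R : realType) (n : nat) (M : manifold R n).
Implicit Types (f g : smooth_fun M) (z : M).

(** What the proof uses of a chart, expressed by global functions: where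
    [lc_bump] does not vanish, [lc_X] are coordinates and the derivations
    [lc_d] of the whole algebra are the partial derivatives. *)
Record local_coords := LocalCoords {
  lc_bump : smooth_fun M;
  lc_X : 'I_n -> smooth_fun M;
  lc_d : 'I_n -> smooth_fun M -> smooth_fun M;
  lc_bump01 : forall z, 0 <= lc_bump z <= 1;
  lc_d_linear : forall i c f g, lc_d i (c *: f + g) = c *: lc_d i f + lc_d i g;
  lc_dM : forall i f g, lc_d i (f * g) = f * lc_d i g + g * lc_d i f;
  lc_dX : forall i j z, lc_bump z != 0 -> \forall w \near z, lc_d i (lc_X j) w = (i == j)%:R;
  lc_hadamard : forall f z, lc_bump z != 0 -> exists h : 'I_n -> smooth_fun M,
    \forall w \near z, f w = f z + \sum_i (lc_X i w - lc_X i z) * h i w;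
  lc_inj : forall z w, lc_bump z != 0 -> lc_bump w != 0 ->
    (forall i, lc_X i z = lc_X i w) -> z = w }.

Section FromChart.
Variables (U : set M) (V : set 'rV[R]_n) (u : M -> 'rV[R]_n) (v : 'rV[R]_n -> M).
Hypothesis uv : @diffeo_on R M (euclidean R n) U V u v.
Variables (y0 : 'rV[R]_n) (r : R).
Hypothesis r0 : 0 < r.
Let rle s t : (s <= t)%N -> s%:R * r <= t%:R * r.
Proof. by move=> st; rewrite ler_pM2r // ler_nat. Qed.
Let rlt s t (x : 'rV[R]_n) : (s <= t)%N -> `|x - y0| < s%:R * r -> `|x - y0| < t%:R * r.
Proof. by move=> st xs; apply: lt_le_trans xs _; exact: rle. Qed.
Hypothesis KV : forall x, `|x - y0| <= 8 * r -> V x.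

(** Nested bumps: [b2] is [1] where [b1] lives, and [b3] is [1] where [b2]
    lives.  The last one turns functions of the chart into global ones, the
    middle one does the same for their partial derivatives, and the first one
    marks a region where neither cutoff is felt. *)
Variables b1 b2 b3 : 'rV[R]_n -> R.
Hypotheses (sb1 : smooth_on setT b1) (sb2 : smooth_on setT b2) (sb3 : smooth_on setT b3).
Hypothesis b1_01 : forall x, 0 <= b1 x <= 1.
Hypothesis b2_1 : forall x, `|x - y0| <= 2 * r -> b2 x = 1.
Hypothesis b3_1 : forall x, `|x - y0| <= 4 * r -> b3 x = 1.
Hypothesis b1s : forall x, b1 x != 0 -> `|x - y0| < 2 * r.
Hypothesis b2s : forall x, b2 x != 0 -> `|x - y0| < 4 * r.
Hypothesis b3s : forall x, b3 x != 0 -> `|x - y0| < 8 * r.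

Let supp (b phi : 'rV[R]_n -> R) s : s <= 8 * r -> (forall x, b x != 0 -> `|x - y0| < s) ->
  forall x, b x * phi x != 0 -> `|x - y0| <= 8 * r.
Proof.
move=> sr bs x; rewrite mulf_eq0 negb_or => /andP[/bs h _].
by apply: le_trans (ltW h) sr.
Qed.

Let smoothM (b phi : 'rV[R]_n -> R) : smooth_on setT b -> smooth_on setT phi ->
  smooth_on setT (fun x => b x * phi x).
Proof. by move=> h1 h2 k; apply: CkM => //; exact: openT. Qed.

Let bump : smooth_fun M.
Proof.
apply: (@mk_smooth R n M (push_fun U u (fun x => b1 x * 1))).
apply: (push_smooth uv KV); first by apply: smoothM => // k; exact: Ck_cst.
by apply: (@supp b1 (fun=> 1) (2 * r)) => //; exact: rle.
Defined.

Let X (i : 'I_n) : smooth_fun M.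
Proof.
apply: (@mk_smooth R n M (push_fun U u (fun x => b3 x * x 0 i))).
apply: (push_smooth uv KV); first by apply: smoothM => //; exact: smooth_on_coord.
by apply: (@supp b3 (fun x => x 0 i) (8 * r)) => //; exact: rle.
Defined.

Let loc f (x : 'rV[R]_n) : R := b3 x * f (v x).

Let loc_smooth f : smooth_on setT (loc f).
Proof. by apply: (pull_smooth uv KV) => // x /b3s /ltW. Qed.

Let d (i : 'I_n) f : smooth_fun M.
Proof.
apply: (@mk_smooth R n M (push_fun U u (fun x => b2 x * 'D_(delta_mx 0 i) (loc f) x))).
apply: (push_smooth uv KV).
  by apply: smoothM => //; apply: smooth_on_derive; exact: loc_smooth.
by apply: (@supp b2 ('D_(delta_mx 0 i) (loc f)) (4 * r)) => //; exact: rle.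
Defined.

Let open_lt s : open [set x : 'rV[R]_n | `|x - y0| < s].
Proof. by apply: open_comp (@open_lt R s) => z _; exact: dist_continuous. Qed.

Let near_lt s x : `|x - y0| < s -> \forall y \near x, `|y - y0| < s.
Proof. by move=> xs; apply: open_nbhs_nbhs; split=> //; exact: open_lt. Qed.

Let derivable_smooth (g : 'rV[R]_n -> R) i x : smooth_on setT g -> derivable g x (delta_mx 0 i).
Proof. by move=> sg; case: (sg 1) => _ h _; exact: h. Qed.

Let bump_supp z : bump z != 0 -> U z /\ `|u z - y0| < 2 * r.
Proof.
rewrite /= /push_fun; case: asboolP => Uz; last by rewrite eqxx.
by rewrite mulr1 => /b1s.
Qed.

Let uK z : U z -> v (u z) = z. Proof. by case: uv => _ h _ _ _ /h []. Qed.
Let vK x : V x -> u (v x) = x. Proof. by case: uv => _ _ h _ _ /h []. Qed.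
Let Uv x : V x -> U (v x). Proof. by case: uv => _ _ h _ _ /h []. Qed.

Let d_linear i c f g : d i (c *: f + g) = c *: d i f + d i g.
Proof.
apply/smooth_eqP => z; rewrite sfD sfZ /= /push_fun; case: asboolP => Uz; last by rewrite mulr0 addr0.
have -> : loc (c *: f + g) = c *: loc f + loc g.
  by apply/funext => x; rewrite /loc sfD sfZ mulrDr mulrCA.
have df := @derivable_smooth _ i (u z) (loc_smooth f).
have dg := @derivable_smooth _ i (u z) (loc_smooth g).
rewrite deriveD //; last exact: derivableZ.
by rewrite deriveZ // mulrDr mulrCA.
Qed.

(** The cutoff [b3] equals [1] near the points where [b2] does not vanish, so
    that the Leibniz rule holds on the whole manifold. *)
Let dM i f g : d i (f * g) = f * d i g + g * d i f.
Proof.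
apply/smooth_eqP => z; rewrite sfD !sfM /= /push_fun; case: asboolP => Uz; last by rewrite !mulr0 addr0.
have [->|b0] := eqVneq (b2 (u z)) 0; first by rewrite !mul0r !mulr0 addr0.
have lt4 := b2s b0; have b31 : b3 (u z) = 1 by apply: b3_1; exact: ltW.
have df := @derivable_smooth _ i (u z) (loc_smooth f).
have dg := @derivable_smooth _ i (u z) (loc_smooth g).
have -> : 'D_(delta_mx 0 i) (loc (f * g)) (u z) = 'D_(delta_mx 0 i) (loc f * loc g) (u z).
  apply: near_eq_derive.
  apply: (@filterS _ (nbhs (u z)) (nbhs_filter _) _ _ _ (near_lt lt4)) => x xlt.
  by rewrite -[RHS]/(loc f x * loc g x) /loc b3_1 ?ltW// sfM !mul1r.
rewrite deriveM // /loc b31 !uK // !mul1r /GRing.scale /=; ring.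
Qed.

Let dX i j z : bump z != 0 -> \forall w \near z, d i (X j) w = (i == j)%:R.
Proof.
move=> /bump_supp [Uz lt2]; apply: (chart_near uv Uz).
apply: (@filterS _ (nbhs (u z)) (nbhs_filter _) _ _ _ (near_lt lt2)) => x xlt Vx.
rewrite /= push_funE ?vK//; last exact: Uv.
rewrite b2_1 ?ltW// mul1r.
have -> : 'D_(delta_mx 0 i) (loc (X j)) x = 'D_(delta_mx 0 i) (fun x : 'rV[R]_n => x 0 j) x.
  apply: near_eq_derive.
  have xlt4 : `|x - y0| < 4 * r by apply: rlt xlt.
  apply: (@filterS _ (nbhs x) (nbhs_filter _) _ _ _ (near_lt xlt4)) => y ylt.
  have Vy : V y by apply/KV/ltW; apply: rlt ylt.
  rewrite /loc /= push_funE ?vK//; last exact: Uv.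
  by rewrite b3_1 ?ltW// !mul1r.
by case: (@derive_coord R n j i x) => _ ->; rewrite eq_sym.
Qed.

Let had f z : bump z != 0 -> exists h : 'I_n -> smooth_fun M,
  \forall w \near z, f w = f z + \sum_i (X i w - X i z) * h i w.
Proof.
move=> /bump_supp [Uz lt2].
have [h sh hE] := @hadamard R n (u z) (loc f) (loc_smooth f).
have hs i : forall w, smooth_at (push_fun U u (fun x => b3 x * h i x) : M -> R) w.
  apply: (push_smooth uv KV); first exact: smoothM.
  by apply: (@supp b3 (h i) (8 * r)) => //; exact: rle.
exists (fun i => mk_smooth (hs i)).
have b31 x : `|x - y0| < 2 * r -> b3 x = 1 by move=> xlt; apply/b3_1/ltW; apply: rlt xlt.
apply: (chart_near uv Uz).
apply: (@filterS _ (nbhs (u z)) (nbhs_filter _) _ _ _ (near_lt lt2)) => x xlt Vx.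
have := hE x; rewrite /loc !b31 // !mul1r uK // => ->; congr (_ + _).
apply: eq_bigr => i _ /=; have Uvx := Uv Vx; rewrite !push_funE //.
by rewrite !vK // !b31 // !mul1r.
Qed.

Let inj z w : bump z != 0 -> bump w != 0 -> (forall i, X i z = X i w) -> z = w.
Proof.
move=> /bump_supp [Uz z2] /bump_supp [Uw w2] h.
rewrite -(uK Uz) -(uK Uw); congr v; apply/rowP => i.
have := h i; by rewrite /= !push_funE // !b3_1 ?mul1r//; apply/ltW; [apply: rlt w2|apply: rlt z2].
Qed.

Let bump01 z : 0 <= bump z <= 1.
Proof.
rewrite /= /push_fun; case: asboolP => _; last by rewrite lexx ler01.
by rewrite mulr1; exact: b1_01.
Qed.

Definition chart_coords : local_coords :=
  LocalCoords bump01 d_linear dM dX had inj.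

Lemma chart_coords_supp z : lc_bump chart_coords z != 0 -> U z /\ `|u z - y0| < 2 * r.
Proof. exact: bump_supp. Qed.

End FromChart.

(** The support can be taken in any given neighbourhood, so that these bumps
    also separate points from closed sets. *)
Lemma local_coords_exist z (N : set M) : nbhs z N ->
  exists2 L : local_coords, forall w, lc_bump L w != 0 -> N w &
  \forall w \near z, lc_bump L w = 1.
Proof.
move=> zN.
have [U [V [u [v [Uz uv]]]]] := manifold_chart z.
have [[oU oV] uV _ _ _] := uv.
have [Vuz _] := uV z Uz.
have nV : \forall x \near u z, V x /\ N (v x).
  apply: filterI; first exact: open_nbhs_nbhs.
  have [cv _] : smooth_map_at (v : euclidean R n -> M) (u z) by case: uv => _ _ _ _; apply.
  by apply: cv; have [_ ->] := uV z Uz.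
have /nbhs_ballP[e /= e0 eV] := nV.
(* The largest of the three bumps has radius [8 * r = e / 2]. *)
pose r := e / 16; have r0 : 0 < r by rewrite /r; lra.
have KV x : `|x - u z| <= 8 * r -> V x.
  by move=> h; apply: (eV _ _).1; rewrite -ball_normE /= distrC; rewrite /r in h; lra.
have r2 : 0 < 2 * r by lra.
have r4 : 0 < 4 * r by lra.
have [b1 [sb1 b1_01 b1_1 b1s]] := bump_exists (u z) r0.
have [b2 [sb2 b2_01 b2_1 b2s]] := bump_exists (u z) r2.
have [b3 [sb3 b3_01 b3_1 b3s]] := bump_exists (u z) r4.
have b2s' x : b2 x != 0 -> `|x - u z| < 4 * r by move/b2s; lra.
have b3s' x : b3 x != 0 -> `|x - u z| < 8 * r by move/b3s; lra.
pose L := chart_coords uv r0 KV sb1 sb2 sb3 b1_01 b2_1 b3_1 b1s b2s' b3s'.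
exists L => [w|].
  move=> /chart_coords_supp [Uw w2]; have [_ <-] := uV w Uw.
  by apply: (eV _ _).2; rewrite -ball_normE /= distrC; rewrite /r in w2; lra.
apply: (chart_near uv Uz).
apply/nbhs_ballP; exists r => //= x; rewrite -ball_normE /= distrC => xr Vx.
rewrite push_funE ?mulr1; last by have [_ _ h _ _] := uv; case: (h x Vx).
by have [_ _ h _ _] := uv; case: (h x Vx) => _ ->; apply: b1_1; exact: ltW.
Qed.

End LocalCoordinates.

(** * Characters of the algebra of smooth functions *)

Section Characters.
Variables (R : realType) (n : nat) (M : manifold R n).
Implicit Types (f g : smooth_fun M) (z w : M).

Lemma smooth_atV (f : M -> R) z : smooth_at f z -> f z != 0 -> smooth_at (fun w => (f w)^-1) z.
Proof.
move=> sf f0; have [U [V [u [v [Uz uv]]]]] := manifold_chart z.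
have [[oU oV] uV _ _ _] := uv; have [Vuz vuz] := uV z Uz.
have sfv : Rn_smooth_at (f \o v) (u z) by apply: (chart_pull uv Vuz); rewrite vuz.
have := chart_smooth uv Uz (Rn_smoothV sfv _); rewrite /= vuz => /(_ f0).
apply: smooth_near; near=> w; rewrite /=.
have Uw : U w by near: w; exact: open_nbhs_nbhs.
by have [_ ->] := uV w Uw.
Unshelve. all: by end_near. Qed.

(** By second countability: each basic open set on which some bump function is
    [1] contributes one such function. *)
Lemma bump_cover : exists chi : nat -> smooth_fun M,
  (forall j, chi j = 0 \/ exists L : local_coords M, chi j = lc_bump L) /\
  forall z, exists j, \forall w \near z, chi j w = 1.
Proof.
have [B /countable_injP[e einj] [Bo Bb]] := manifold_second_countable M.
pose good j (L : local_coords M) := exists S, [/\ B S, e S = j & forall w, S w -> lc_bump L w = 1].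
pose chi j := if pselect (exists L, good j L) is left h then lc_bump (projT1 (cid h)) else 0.
exists chi; split=> [j|z].
  by rewrite /chi; case: pselect => h; [right; eexists|left].
have [L _ L1] := local_coords_exist (filterT : nbhs z setT).
have [S [BS Sz] SL] := Bb z _ L1.
exists (e S).
have gS : exists L, good (e S) L by exists L, S; split=> // w /SL.
have : nbhs z S by apply: open_nbhs_nbhs; split=> //; exact: Bo.
apply: filterS => w Sw; rewrite /chi; case: pselect => // h.
have [S' [BS' eS' h']] := projT2 (cid h); apply: h'.
by rewrite (einj S' S) ?inE.
Qed.

Variable c : smooth_fun M -> R.
Hypothesis c_linear : forall a f g, c (a *: f + g) = a * c f + c g.
Hypothesis cM : forall f g, c (f * g) = c f * c g.
Hypothesis c1 : c 1 = 1.

Let cD f g : c (f + g) = c f + c g.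
Proof. by rewrite -[f]scale1r c_linear mul1r scale1r. Qed.
Let c0 : c 0 = 0.
Proof. by apply: (addIr (c 0)); rewrite -cD !add0r. Qed.
Let cZ a f : c (a *: f) = a * c f.
Proof. by rewrite -[a *: f]addr0 c_linear c0 addr0. Qed.
Let cB f g : c (f - g) = c f - c g.
Proof. by rewrite -scaleN1r addrC c_linear mulN1r addrC. Qed.
Let cA a : c a%:A = a. Proof. by rewrite cZ c1 mulr1. Qed.
Let c_sum (I : Type) (s : seq I) (F : I -> smooth_fun M) :
  c (\sum_(i <- s) F i) = \sum_(i <- s) c (F i).
Proof. by elim: s => [|i s IH]; rewrite ?big_nil ?c0 // !big_cons cD IH. Qed.
Let c_prod (I : Type) (s : seq I) (F : I -> smooth_fun M) :
  c (\prod_(i <- s) F i) = \prod_(i <- s) c (F i).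
Proof. by elim: s => [|i s IH]; rewrite ?big_nil ?c1 // !big_cons cM IH. Qed.

(** A function without zeros is invertible, and characters preserve units. *)
Lemma character_zero f : c f = 0 -> exists z, f z = 0.
Proof.
move=> cf; apply/not_existsP => f0.
have f0' z : f z != 0 by apply/eqP; exact: f0.
pose g := mk_smooth (fun z => smooth_atV (smooth_funP f z) (f0' z)).
have fg : f * g = 1 by apply/smooth_eqP => z; rewrite sfM sf1 /= divff.
by have := cM f g; rewrite fg c1 cf mul0r => /eqP; rewrite oner_eq0.
Qed.

(** If [c f < 0] then [f - c f] is positive, yet [c] kills it. *)
Lemma character_ge0 f : (forall z, 0 <= f z) -> 0 <= c f.
Proof.
move=> f0; rewrite leNgt; apply/negP => cf0.
have [z] : exists z, (f - (c f)%:A) z = 0 by apply: character_zero; rewrite cB cA subrr.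
by rewrite sfB sfA => e; have := f0 z; lra.
Qed.

(** Otherwise [c] sends each product [P i] of the [1 - chi j] for [j < i] to
    [1].  The sum of all the [P i] is locally finite, hence smooth, and bounds
    each of its partial sums, so that its image under [c] would be at least
    [N] for every [N]. *)
Lemma character_bump (chi : nat -> smooth_fun M) :
  (forall j z, 0 <= chi j z <= 1) -> (forall z, exists j, \forall w \near z, chi j w = 1) ->
  exists j, c (chi j) != 0.
Proof.
move=> chi01 cover; apply/not_existsP => h.
have cchi j : c (chi j) = 0 by apply/eqP/negPn/negP; exact: h.
pose P i : smooth_fun M := \prod_(j < i) (1 - chi j).
have PE i z : P i z = \prod_(j < i) (1 - chi j z).
  rewrite /P; elim: i => [|i IH]; first by rewrite !big_ord0.
  by rewrite !big_ord_recr sfM; congr (_ * _); exact: IH.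
have P0 i j z : chi j z = 1 -> (j < i)%N -> P i z = 0.
  by move=> e ji; rewrite PE (bigD1 (Ordinal ji)) //= e subrr mul0r.
have Pge0 i z : 0 <= P i z.
  by rewrite PE; apply: prodr_ge0 => j _; rewrite subr_ge0; case/andP: (chi01 j z).
have [m hm] := choice cover.
have m1 z : chi (m z) z = 1 := nbhs_singleton (hm z).
pose F z := \sum_(i < (m z).+1) P i z.
have tail N j z : chi j z = 1 -> (j < N)%N -> \sum_(i < N) P i z = \sum_(i < j.+1) P i z.
  move=> e jN; rewrite (big_ord_widen N (fun i => P i z) jN) [LHS](bigID (fun i : 'I_N => (i < j.+1)%N)) /=.
  rewrite [X in _ + X]big1 ?addr0// => i; rewrite -leqNgt => ji; exact: P0 e ji.
have FE j z : chi j z = 1 -> F z = \sum_(i < j.+1) P i z.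
  move=> e; pose N := (maxn (m z) j).+1.
  by rewrite /F -(tail N (m z)) ?ltnS ?leq_maxl// -(tail N j) ?ltnS ?leq_maxr.
have sF z : smooth_at F z.
  have := smooth_funP (\sum_(i < (m z).+1) P i) z; apply: smooth_near.
  by apply: filterS (hm z) => w e; rewrite sf_sum (FE _ _ e).
pose G := mk_smooth sF.
have cG N : N%:R <= c G.
  have -> : N%:R = c (\sum_(i < N) P i).
    rewrite c_sum (eq_bigr (fun=> 1)) ?sumr_const ?card_ord// => i _.
    by rewrite /P c_prod big1 // => j _; rewrite cB c1 cchi subr0.
  rewrite -subr_ge0 -cB; apply: character_ge0 => z.
  rewrite sfB sf_sum /= subr_ge0.
  pose K := maxn N (m z).+1.
  rewrite /F -(tail K (m z)) //; last exact: leq_maxr.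
  rewrite (big_ord_widen K (fun i => P i z) (leq_maxl _ _)).
  rewrite [leRHS](bigID (fun i : 'I_K => (i < N)%N)) /= lerDl.
  by apply: sumr_ge0 => i _; exact: Pge0.
have := cG (Num.truncn (c G)).+1.
by rewrite leNgt truncnS_gt.
Qed.

(** Some bump function is not killed by [c].  The sum of the squares of
    [g - c g], where [g] runs through this bump, its coordinates and an
    arbitrary [f], is killed by [c], hence has a zero.  The bump and the
    coordinates determine this zero, which is therefore the same for all
    [f]. *)
Theorem character_eval : exists z, forall f, c f = f z.
Proof.
have [chi [chiL cover]] := bump_cover.
have chi01 j z : 0 <= chi j z <= 1.
  by case: (chiL j) => [->|[L ->]]; [rewrite sf0 lexx ler01|exact: lc_bump01].
have [j cj] := character_bump chi01 cover.
have [L chiE] : exists L : local_coords M, chi j = lc_bump L.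
  by case: (chiL j) => // e; rewrite e c0 eqxx in cj.
rewrite {}chiE {chiL chi01 cover chi} in cj.
pose q (f : smooth_fun M) : smooth_fun M := (f - (c f)%:A) * (f - (c f)%:A).
have qge0 f z : 0 <= q f z by rewrite /q sfM -expr2 sqr_ge0.
have cq f : c (q f) = 0 by rewrite /q cM cB cA subrr mul0r.
have q0 f z : q f z = 0 -> f z = c f.
  by rewrite /q sfM => /eqP; rewrite mulf_eq0 orbb sfB sfA subr_eq0 => /eqP.
have pt f : exists z, [/\ lc_bump L z = c (lc_bump L),
    forall i, lc_X L i z = c (lc_X L i) & f z = c f].
  have [z] : exists z, (q (lc_bump L) + q f + \sum_i q (lc_X L i)) z = 0.
    apply: character_zero; rewrite !cD !cq c_sum big1 ?addr0// => i _; exact: cq.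
  rewrite !sfD sf_sum => /eqP; rewrite paddr_eq0; last 2 first.
  - by rewrite addr_ge0.
  - by apply: sumr_ge0.
  rewrite paddr_eq0 // => /andP[/andP[/eqP h1 /eqP h2]].
  rewrite psumr_eq0 // => /allP h3; exists z; split; [exact: q0| |exact: q0].
  by move=> i; apply/q0/eqP; apply: h3; rewrite mem_index_enum.
have [z [zb zX _]] := pt 0; exists z => f.
have [w [wb wX wf]] := pt f; rewrite -wf; congr (f _).
by apply: (@lc_inj _ _ _ L); rewrite ?zb ?wb// => i; rewrite zX wX.
Qed.

End Characters.

(** * Morphisms of algebras *)

Section LRMorphisms.
Variables (R : nzRingType) (U V : lalgType R).

Definition mk_lrmorphism (f : U -> V) (fL : linear f) (fM : monoid_morphism f) :
    {lrmorphism U -> V} :=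
  let m1 := GRing.isLinear.Build R U V *:%R f fL in
  let m2 := GRing.isMonoidMorphism.Build U V f fM in
  HB.pack f m1 m2.

Lemma mk_lrmorphismE f fL fM x : @mk_lrmorphism f fL fM x = f x.
Proof. by []. Qed.

Lemma lrmorphism_eq (p q : {lrmorphism U -> V}) : p =1 q -> p = q.
Proof.
case: p q => [f [[a1] [b1] [c1]]] [g [[a2] [b2] [c2]]] /= /funext fg.
subst g.
by rewrite (Prop_irrelevance a1 a2) (Prop_irrelevance b1 b2) (Prop_irrelevance c1 c2).
Qed.

End LRMorphisms.

(** * Residues and nilpotency in a Weil algebra *)

Section WeilAlgebra.
Variables (R : realType) (A : weilAlgebra R).
Implicit Types a b : A.

(** Stated with elements rather than with powers of subspaces: in this form it
    passes to quotients by lifting the factors. *)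
Definition nilpotent_max N :=
  forall s : seq A, (N <= size s)%N -> {subset s <= weil_max A} -> \prod_(a <- s) a = 0.

Lemma weil_unit a : (a \is a GRing.unit) = (a \notin weil_max A).
Proof. by rewrite weil_local negbK. Qed.

Lemma weil_1 : 1 \notin weil_max A.
Proof. by rewrite -weil_unit unitr1. Qed.

Lemma weil_maxMr a b : a \in weil_max A -> a * b \in weil_max A.
Proof.
rewrite !weil_local; apply: contra; rewrite unitrM_comm; first by case/andP.
exact: weil_mulC.
Qed.

Lemma weil_maxMl a b : b \in weil_max A -> a * b \in weil_max A.
Proof. by rewrite weil_mulC; exact: weil_maxMr. Qed.

Definition residue a : R := projT1 (cid (weil_residue a)).

Lemma residueP a : a - (residue a)%:A \in weil_max A.
Proof. exact: (projT2 (cid (weil_residue a))). Qed.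

Lemma residue_uniq a c : a - c%:A \in weil_max A -> residue a = c.
Proof.
move=> h; have := rpredB (residueP a) h; rewrite opprB addrCA addrAC subrr add0r.
move=> hm; apply/eqP; rewrite eq_sym -subr_eq0; apply: contraT => d0.
have : (c - residue a)^-1 *: (c%:A - (residue a)%:A : A) \in weil_max A by exact: memvZ.
rewrite -scalerBl scalerA mulVf // scale1r => h1.
by have := weil_1; rewrite h1.
Qed.

Lemma residue_max a : (residue a == 0) = (a \in weil_max A).
Proof.
apply/eqP/idP => [a0|am]; first by have := residueP a; rewrite a0 scale0r subr0.
by apply: residue_uniq; rewrite scale0r subr0.
Qed.

Lemma residue_unit a : residue a != 0 -> a \is a GRing.unit.
Proof. by rewrite residue_max weil_unit. Qed.

Lemma residue_linear c a b : residue (c *: a + b) = c * residue a + residue b.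
Proof.
apply: residue_uniq; rewrite scalerDl -scalerA opprD addrACA -scalerBr.
by apply: memvD (residueP b); exact: memvZ (residueP a).
Qed.

Lemma residueM a b : residue (a * b) = residue a * residue b.
Proof.
apply: residue_uniq.
have -> : a * b - (residue a * residue b)%:A =
    (a - (residue a)%:A) * b + residue a *: (b - (residue b)%:A).
  by rewrite mulrBl -scalerAl mul1r scalerBr scalerA addrA subrK.
by apply: memvD; [apply: weil_maxMr; exact: residueP|exact: memvZ (residueP b)].
Qed.

Lemma residue1 : residue 1 = 1.
Proof. by apply: residue_uniq; rewrite scale1r subrr mem0v. Qed.

Lemma prod_max (s : seq A) : {subset s <= weil_max A} ->
  \prod_(a <- s) a \in (weil_max A ^+ size s)%VS.
Proof.
elim: s => [|a s IH] h; first by rewrite big_nil expv0 memv_line.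
rewrite big_cons /= expvSl; apply: memv_mul; first by apply: h; rewrite mem_head.
by apply: IH => b bs; apply: h; rewrite in_cons bs orbT.
Qed.

Lemma height_nilpotent l : height A l -> nilpotent_max l.+1.
Proof.
move=> [_ hl] s ls /prod_max; rewrite -(subnKC ls) expvD hl prod0v memv0.
by move/eqP.
Qed.

End WeilAlgebra.

(** * Quotients of Weil algebras *)

Section Quotient.
Variables (R : realType) (A : weilAlgebra R) (B : falgType R) (phi : {lrmorphism A -> B}).
Variables (J : {vspace A}) (N : nat).
Hypothesis phiJ : is_quotient phi J.
Hypothesis JA : (J <= weil_max A)%VS.
Hypothesis nilA : nilpotent_max A N.

Let phi_onto b : exists a, phi a = b. Proof. by case: phiJ. Qed.
Let phi_ker a : (phi a == 0) = (a \in J). Proof. by case: phiJ. Qed.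

Let maxB : {vspace B} := (linfun phi @: weil_max A)%VS.

Let maxBP a : (phi a \in maxB) = (a \in weil_max A).
Proof.
apply/idP/idP => [/memv_imgP[a' ha']|ha].
  rewrite lfunE /= => e; have : a - a' \in weil_max A.
    by apply: (subvP JA); rewrite -phi_ker rmorphB /= e subrr.
  by move=> h; rewrite -[a](subrK a'); exact: memvD.
by apply/memv_imgP; exists a => //; rewrite lfunE.
Qed.

Let mulBC : commutative (@GRing.mul B).
Proof.
move=> x y; have [a <-] := phi_onto x; have [b <-] := phi_onto y.
by rewrite -!rmorphM weil_mulC.
Qed.

(** The image of a nilpotent element is nilpotent, hence not a unit, and the
    image of a unit is a unit. *)
Let localB b : (b \in maxB) = (b \isn't a GRing.unit).
Proof.
have [a <-] := phi_onto b; rewrite maxBP; apply/idP/idP => [am|]; last first.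
  by apply: contraR; rewrite -weil_unit => au; exact: rmorph_unit.
apply/negP => u; have : \prod_(b <- nseq N a) b = 0.
  apply: nilA => [|x]; first by rewrite size_nseq.
  by rewrite mem_nseq => /andP[_ /eqP ->].
rewrite big_nseq iter_mulr_1 => aN.
have := rmorphXn phi N a; rewrite [a ^+ N]aN rmorph0 => e.
by have := unitrX N u; rewrite -e unitr0.
Qed.

Let residueB b : exists c : R, b - c%:A \in maxB.
Proof.
have [a <-] := phi_onto b; have [c hc] := weil_residue a; exists c.
by rewrite -(rmorph_alg phi) -rmorphB maxBP.
Qed.

Definition weil_quotient : weilAlgebra R := WeilAlgebra mulBC localB residueB.

Lemma weil_quotient_max a : (phi a \in weil_max weil_quotient) = (a \in weil_max A).
Proof. exact: maxBP. Qed.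

Lemma weil_quotient_nilpotent : nilpotent_max weil_quotient N.
Proof.
move=> s sN sm.
have [s' [sE s'm]] : exists s' : seq A, s = map phi s' /\ {subset s' <= weil_max A}.
  elim: s {sN} sm => [|b s IH] h; first by exists [::].
  have [b' e] := phi_onto b.
  have [s' [-> hs']] : exists s' : seq A, s = map phi s' /\ {subset s' <= weil_max A}.
    by apply: IH => x xs; apply: h; rewrite in_cons xs orbT.
  exists (b' :: s'); rewrite /= e; split=> // x; rewrite in_cons => /orP[/eqP ->|/hs' //].
  by rewrite -maxBP e; apply: h; rewrite mem_head.
rewrite sE big_map -rmorph_prod /= nilA ?rmorph0//.
by rewrite sE size_map in sN.
Qed.

End Quotient.

(** * Points of the Weil bundle *)

Lemma leibniz_weights (R : pzRingType) (V : lmodType R) (F : nat -> V) k :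
  \sum_(i < k.+1) (i.+1%:R *: F i.+1 + (k.+1 - i)%:R *: F i) = k.+1%:R *: \sum_(i < k.+2) F i.
Proof.
rewrite big_split /= scaler_sumr.
have -> : \sum_(i < k.+1) i.+1%:R *: F i.+1 = \sum_(i < k.+2) i%:R *: F i.
  by rewrite [RHS]big_ord_recl scale0r add0r.
have -> : \sum_(i < k.+1) (k.+1 - i)%:R *: F i = \sum_(i < k.+2) (k.+1 - i)%:R *: F i.
  by rewrite [RHS]big_ord_recr /= subnn mulr0n scale0r addr0.
rewrite -big_split /=; apply: eq_bigr => i _.
by rewrite -scalerDl -natrD subnKC // -ltnS.
Qed.

Section Separation.
Variables (R : realType) (n : nat) (M : manifold R n).
Implicit Types (f g : smooth_fun M) (z w : M).

Lemma separating_bump z f : (\forall w \near z, f w = 0) ->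
  exists2 b : smooth_fun M, b z = 1 & f * b = 0.
Proof.
move=> f0; have [L Ls L1] := local_coords_exist f0.
exists (lc_bump L); first exact: nbhs_singleton L1.
apply/smooth_eqP => w; rewrite sfM sf0.
by have [->|/Ls ->] := eqVneq (lc_bump L w) 0; rewrite ?mulr0 ?mul0r.
Qed.

Variable L : local_coords M.

Lemma lc_d0 i : lc_d L i 0 = 0.
Proof.
have := lc_d_linear L i 1 0 0; rewrite !scale1r addr0 => e.
by apply: (addIr (lc_d L i 0)); rewrite -e add0r.
Qed.

Lemma lc_d1 i : lc_d L i 1 = 0.
Proof.
have := lc_dM L i 1 1; rewrite !mul1r => e.
by apply: (addIr (lc_d L i 1)); rewrite -e add0r.
Qed.

(** Derivations are local: [f] is killed by a function equal to [1] at the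
    given point, and the Leibniz rule applies to their product. *)
Lemma lc_d_local i f z : (\forall w \near z, f w = 0) -> \forall w \near z, lc_d L i f w = 0.
Proof.
move=> /nbhs_interior; apply: filterS => w fw.
have [b b1 fb] := separating_bump fw.
have := lc_dM L i f b; rewrite fb lc_d0 => /smooth_eqP /(_ w).
by rewrite sf0 sfD !sfM (nbhs_singleton fw) b1 mul0r mul1r add0r => <-.
Qed.

End Separation.

Section Points.
Variables (R : realType) (n : nat) (M : manifold R n) (A : weilAlgebra R).
Implicit Types (f g : smooth_fun M) (z w : M).

(** The projection of [p] to the manifold is [z]. *)
Definition based (p : {lrmorphism smooth_fun M -> A}) z :=
  forall f, p f - (f z)%:A \in weil_max A.

(** The residue of a morphism is a character of the algebra of functions. *)
Lemma based_exists (p : {lrmorphism smooth_fun M -> A}) : exists z, based p z.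
Proof.
have [|||z hz] := @character_eval R n M (fun f => residue (p f)).
- by move=> a f g; rewrite linearP residue_linear.
- by move=> f g; rewrite rmorphM residueM.
- by rewrite rmorph1 residue1.
by exists z => f; rewrite -hz; exact: residueP.
Qed.

Lemma based_residue p z f : based p z -> residue (p f) = f z.
Proof. by move=> pz; apply: residue_uniq. Qed.

Lemma based_unit p z f : based p z -> f z != 0 -> p f \is a GRing.unit.
Proof. by move=> pz fz; apply: residue_unit; rewrite (based_residue _ pz). Qed.

(** [f] is killed by a function with value [1] at [z], whose image is a unit. *)
Lemma point_local p z f : based p z -> (\forall w \near z, f w = 0) -> p f = 0.
Proof.
move=> pz /separating_bump [b b1 fb].
have pb : p b \is a GRing.unit by apply: (based_unit pz); rewrite b1 oner_neq0.
by apply: (mulIr pb); rewrite mul0r -rmorphM fb rmorph0.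
Qed.

(** Twisted derivations cover at once the derivations over a point [p], with
    [q = p], and the differences [p - q] of two points. *)
Section TwistedDerivations.
Variables (p q : {lrmorphism smooth_fun M -> A}) (z : M) (delta : smooth_fun M -> A).
Hypotheses (pz : based p z) (qz : based q z).
Hypothesis deltaL : forall c f g, delta (c *: f + g) = c *: delta f + delta g.
Hypothesis deltaM : forall f g, delta (f * g) = p f * delta g + q g * delta f.

Lemma tder0 : delta 0 = 0.
Proof.
have := deltaL 1 0 0; rewrite !scale1r addr0 => e.
by apply: (addIr (delta 0)); rewrite -e add0r.
Qed.

Lemma tderD f g : delta (f + g) = delta f + delta g.
Proof. by rewrite -[f]scale1r deltaL !scale1r. Qed.

Lemma tderZ c f : delta (c *: f) = c *: delta f.
Proof. by rewrite -[c *: f]addr0 deltaL tder0 addr0. Qed.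

Lemma tderB f g : delta (f - g) = delta f - delta g.
Proof. by rewrite tderD -[- g]scaleN1r tderZ scaleN1r. Qed.

Lemma tder1 : delta 1 = 0.
Proof.
have := deltaM 1 1; rewrite !rmorph1 !mul1r => e.
by apply: (addIr (delta 1)); rewrite -e add0r.
Qed.

Lemma tder_local f : (\forall w \near z, f w = 0) -> delta f = 0.
Proof.
move=> f0; have [b b1 fb] := separating_bump f0.
have qb : q b \is a GRing.unit by apply: (based_unit qz); rewrite b1 oner_neq0.
have := deltaM f b; rewrite fb tder0 (point_local pz f0) mul0r add0r => e.
by apply: (mulrI qb); rewrite mulr0 -e.
Qed.

Lemma tder_sum (I : Type) (s : seq I) (F : I -> smooth_fun M) :
  delta (\sum_(i <- s) F i) = \sum_(i <- s) delta (F i).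
Proof. by elim: s => [|i s IH]; rewrite ?big_nil ?tder0 // !big_cons tderD IH. Qed.

(** By Hadamard's lemma, [delta f] is a combination of other values of [delta]
    with coefficients [p (X_i - X_i z)] in the maximal ideal; iterating, it is
    a combination with coefficients in every power of this ideal. *)
Lemma tder_eq0 (L : local_coords M) N : nilpotent_max A N -> lc_bump L z != 0 ->
  (forall i, delta (lc_X L i) = 0) -> forall f, delta f = 0.
Proof.
move=> nilA bz dX f.
suff : forall k (s : seq A) f, (size s + k = N)%N -> {subset s <= weil_max A} ->
    \prod_(a <- s) a * delta f = 0.
  move=> /(_ N [::] f); rewrite big_nil mul1r; apply=> //.
elim=> [|k IH] s g sk sm.
  by rewrite nilA ?mul0r// -sk addn0.
have [h hh] := lc_hadamard g bz.
pose g' : smooth_fun M := (g z)%:A + \sum_i (lc_X L i - (lc_X L i z)%:A) * h i.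
have -> : delta g = delta g'.
  apply/eqP; rewrite -subr_eq0 -tderB; apply/eqP/tder_local.
  apply: filterS hh => w e; rewrite sfB /g' sfD sfA sf_sum e.
  by apply/eqP; rewrite subr_eq0; apply/eqP; congr (_ + _); apply: eq_bigr => i _; rewrite sfM sfB sfA.
rewrite /g' tderD tderZ tder1 scaler0 add0r tder_sum mulr_sumr big1 // => i _.
rewrite deltaM tderB tderZ tder1 dX scaler0 subrr mulr0 addr0 mulrA.
have -> : \prod_(a <- s) a * p (lc_X L i - (lc_X L i z)%:A) =
    \prod_(a <- rcons s (p (lc_X L i - (lc_X L i z)%:A))) a by rewrite big_rcons.
rewrite IH //; first by rewrite size_rcons addSnnS.
move=> a; rewrite mem_rcons in_cons => /orP[/eqP ->|/sm //].
by rewrite linearB linearZ /= rmorph1; exact: pz.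
Qed.

End TwistedDerivations.

(** The difference of two points is a twisted derivation. *)
Lemma point_ext (L : local_coords M) N (p q : {lrmorphism smooth_fun M -> A}) z :
  nilpotent_max A N -> lc_bump L z != 0 -> based p z -> based q z ->
  (forall i, p (lc_X L i) = q (lc_X L i)) -> p =1 q.
Proof.
move=> nilA Lz pz qz e f; apply/eqP; rewrite -subr_eq0; apply/eqP.
apply: (@tder_eq0 p q z (fun f => p f - q f) pz qz _ _ L N nilA Lz) => [c g h|g h|i].
- by rewrite (linearP p) (linearP q) scalerBr opprD addrACA.
- rewrite (rmorphM p) (rmorphM q) !mulrBr.
  by rewrite (weil_mulC (q h) (p g)) (weil_mulC (q h) (q g)) addrA subrK.
- by rewrite e subrr.
Qed.

Section Taylor.
Variables (L : local_coords M) (z : M) (a : 'I_n -> A) (N : nat).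
Hypothesis aM : forall i, a i \in weil_max A.
Hypothesis nilA : nilpotent_max A N.
Hypothesis bz : lc_bump L z != 0.

(** The term of degree [k] of the Taylor expansion of [f] at [z], evaluated at
    the nilpotent increments [a]. *)
Fixpoint taylor_term k f : A :=
  if k is j.+1 then j.+1%:R^-1 *: \sum_i a i * taylor_term j (lc_d L i f) else (f z)%:A.

Lemma taylor_termO f : taylor_term 0 f = (f z)%:A.
Proof. by []. Qed.

Lemma taylor_termS k f :
  \sum_i a i * taylor_term k (lc_d L i f) = k.+1%:R *: taylor_term k.+1 f.
Proof. by rewrite [X in _ *: X]/= scalerA divff ?scale1r// pnatr_eq0. Qed.

Lemma taylor_termSE k f :
  taylor_term k.+1 f = k.+1%:R^-1 *: \sum_i a i * taylor_term k (lc_d L i f).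
Proof. by []. Qed.

Lemma taylor_term_linear k c f g :
  taylor_term k (c *: f + g) = c *: taylor_term k f + taylor_term k g.
Proof.
elim: k f g => [|k IH] f g; first by rewrite !taylor_termO sfD sfZ scalerDl scalerA.
rewrite !taylor_termSE.
rewrite scalerA mulrC -scalerA -scalerDr; congr (_ *: _).
rewrite scaler_sumr -big_split /=; apply: eq_bigr => i _.
by rewrite lc_d_linear IH mulrDr scalerAr.
Qed.

Lemma taylor_term0 k : taylor_term k 0 = 0.
Proof.
have := taylor_term_linear k 1 0 0; rewrite !scale1r addr0 => e.
by apply: (addIr (taylor_term k 0)); rewrite -e add0r.
Qed.

Lemma taylor_termD k f g : taylor_term k (f + g) = taylor_term k f + taylor_term k g.
Proof. by rewrite -[f]scale1r taylor_term_linear !scale1r. Qed.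

Lemma taylor_term1 k : taylor_term k 1 = (k == 0)%:R.
Proof.
case: k => [|k]; first by rewrite taylor_termO sf1 scale1r.
rewrite taylor_termSE big1 ?scaler0// => i _; by rewrite lc_d1 taylor_term0 mulr0.
Qed.

Lemma taylor_term_local k f : (\forall w \near z, f w = 0) -> taylor_term k f = 0.
Proof.
elim: k f => [|k IH] f f0; first by rewrite taylor_termO (nbhs_singleton f0) scale0r.
rewrite taylor_termSE big1 ?scaler0// => i _; rewrite IH ?mulr0//; exact: lc_d_local.
Qed.

Lemma taylor_termX k i : taylor_term k (lc_X L i) =
  if k == 0 then (lc_X L i z)%:A else if k == 1 then a i else 0.
Proof.
case: k => [|k] //.
have dE j : taylor_term k (lc_d L j (lc_X L i)) = (j == i)%:R *: (k == 0)%:R.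
  rewrite -taylor_term1 -[lc_d L j _](subrK ((j == i)%:R *: 1)) taylor_termD.
  rewrite taylor_term_local ?add0r; last first.
    apply: filterS (lc_dX j i bz) => w e.
    by rewrite sfB sfZ sf1 mulr1 e subrr.
  by rewrite -[X in taylor_term k X]addr0 taylor_term_linear taylor_term0 addr0.
rewrite taylor_termSE; under eq_bigr => j _ do rewrite dE.
rewrite (bigD1 i) //= big1 => [|j /negbTE ->]; last by rewrite scale0r mulr0.
rewrite eqxx scale1r addr0; case: k {dE} => [|k]; first by rewrite mulr1 invr1 scale1r.
by rewrite mulr0 scaler0.
Qed.

(** The terms are the divided powers of the derivation [sum_i a i * d_i], which
    is why no binomial coefficient appears. *)
Lemma taylor_termM k f g : taylor_term k (f * g) =
  \sum_(i < k.+1) taylor_term i f * taylor_term (k - i) g.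
Proof.
elim: k f g => [|k IH] f g.
  by rewrite big_ord1 !taylor_termO sfM -scalerAl mul1r scalerA.
pose F i := taylor_term i f * taylor_term (k.+1 - i) g.
have E : \sum_i a i * taylor_term k (lc_d L i (f * g)) = k.+1%:R *: \sum_(i < k.+2) F i.
  transitivity (\sum_(i < k.+1) (i.+1%:R *: F i.+1 + (k.+1 - i)%:R *: F i)).
    transitivity (\sum_l (a l * taylor_term k (lc_d L l f * g) +
        a l * taylor_term k (f * lc_d L l g))).
      apply: eq_bigr => l _.
      by rewrite lc_dM (mulrC g) taylor_termD mulrDr addrC.
    rewrite !big_split; congr (_ + _).
      under eq_bigr => l _ do rewrite IH mulr_sumr.
      rewrite exchange_big; apply: eq_bigr => j _.
      rewrite /F subSS scalerAl -taylor_termS mulr_suml; apply: eq_bigr => l _.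
      by rewrite mulrA.
    under eq_bigr => l _ do rewrite IH mulr_sumr.
    rewrite exchange_big; apply: eq_bigr => j _.
    have e : (k.+1 - j)%N = (k - j).+1 by rewrite subSn // -ltnS.
    rewrite /F e scalerAr -taylor_termS mulr_sumr; apply: eq_bigr => l _.
    by rewrite mulrA (weil_mulC (a l)) -mulrA.
  exact: leibniz_weights.
by rewrite taylor_termSE E scalerA mulVf ?scale1r// pnatr_eq0.
Qed.

(** Each unit of degree contributes a factor in the maximal ideal; the sequence
    [s] collects the factors already extracted. *)
Lemma taylor_termM_eq0 (s : seq A) i j f g : {subset s <= weil_max A} ->
  (N <= size s + i + j)%N ->
  \prod_(b <- s) b * (taylor_term i f * taylor_term j g) = 0.
Proof.
have step (s' : seq A) k h (c : A) :
    (forall l, \prod_(b <- rcons s' (a l)) b * (taylor_term k (lc_d L l h) * c) = 0) ->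
    \prod_(b <- s') b * (taylor_term k.+1 h * c) = 0.
  move=> E; rewrite taylor_termSE -scalerAl -scalerAr mulr_suml mulr_sumr big1 ?scaler0// => l _.
  by rewrite -[RHS](E l) big_rcons !mulrA.
have rc (s' : seq A) l : {subset s' <= weil_max A} -> {subset rcons s' (a l) <= weil_max A}.
  by move=> h b; rewrite mem_rcons in_cons => /orP[/eqP ->|/h].
elim: i s f g => [|i IH] s f g sm.
  rewrite addn0; elim: j s g sm => [|j IH] s g sm sN.
    by rewrite nilA ?mul0r// -[size s]addn0.
  rewrite (weil_mulC (taylor_term 0 f)); apply: step => l; rewrite (weil_mulC (taylor_term j _)).
  by apply: IH; [exact: rc|rewrite size_rcons addSnnS].
move=> sN; apply: step => l; apply: IH; first exact: rc.
by rewrite size_rcons addSnnS.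
Qed.

(** The generating polynomial of the terms turns [taylor_termM] into the
    multiplicativity of [taylor].  The bound exceeds the order of nilpotency by
    two, so that the terms of degree [0] and [1] are always present. *)
Definition taylor_poly f : {poly A} := \poly_(k < N.+2) taylor_term k f.

Definition taylor f : A := (taylor_poly f).[1].

Lemma taylorE f : taylor f = \sum_(k < N.+2) taylor_term k f.
Proof. by rewrite /taylor horner_poly; apply: eq_bigr => k _; rewrite expr1n mulr1. Qed.

Lemma taylor_polyM f g : taylor_poly (f * g) = taylor_poly f * taylor_poly g.
Proof.
apply/polyP => k; rewrite coefM coef_poly; case: ltnP => kN.
  rewrite taylor_termM; apply: eq_bigr => i _; rewrite !coef_poly.
  have ik : (i <= k)%N by rewrite -ltnS.
  by rewrite !ifT // ?(leq_ltn_trans _ kN)// leq_subr.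
rewrite big1 // => i _; rewrite !coef_poly.
case: ifP => _; last by rewrite mul0r.
case: ifP => _; last by rewrite mulr0.
have := @taylor_termM_eq0 [::] i (k - i) f g; rewrite big_nil mul1r; apply=> //.
rewrite add0n subnKC; first exact: leq_trans (leqW (leqnSn _)) kN.
by rewrite -ltnS.
Qed.

Fact taylor_linear : linear taylor.
Proof.
move=> c f g; rewrite !taylorE scaler_sumr -big_split; apply: eq_bigr => k _.
exact: taylor_term_linear.
Qed.

Fact taylor_monoid : monoid_morphism taylor.
Proof.
split=> [|f g].
  rewrite taylorE big_ord_recl taylor_term1 big1 ?addr0// => k _.
  by rewrite taylor_term1.
by rewrite /taylor taylor_polyM hornerM_comm // /comm_poly mulr1 mul1r.
Qed.

Definition taylor_mor : {lrmorphism smooth_fun M -> A} :=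
  mk_lrmorphism taylor_linear taylor_monoid.

Lemma taylor_based : based taylor_mor z.
Proof.
move=> f; rewrite mk_lrmorphismE taylorE big_ord_recl taylor_termO addrAC subrr add0r.
apply: memv_suml => k _; rewrite taylor_termSE; apply: memvZ.
by apply: memv_suml => i _; apply: weil_maxMr.
Qed.

Lemma taylor_X i : taylor_mor (lc_X L i) = (lc_X L i z)%:A + a i.
Proof.
rewrite mk_lrmorphismE taylorE !big_ord_recl !taylor_termX.
by rewrite big1 => [|k _]; [rewrite addr0|rewrite taylor_termX].
Qed.

End Taylor.

End Points.

(** * Smooth maps into initial spaces *)

Section SmoothMaps.
Variable R : realType.

(** The spaces whose smooth functions are closed under composition with smooth
    functions of several real variables; the axioms of a functionally
    structured space only give sums and products. *)
Definition composition_closed (Z : smoothSpace R) : Prop :=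
  forall m (h : 'I_m -> Z -> R) (F : 'rV[R]_m -> R) (z : Z),
    (forall j, smooth_at (h j) z) -> Rn_smooth_at F (\row_j h j z) ->
    smooth_at (fun t => F (\row_j h j t)) z.

Section Initial.
Variables (S I : Type) (Y : I -> smoothSpace R) (u : forall i, S -> Y i).
Let X := initial_space u.

Lemma initial_cvg (F : set_system X) (s : X) : Filter F ->
  (forall i, u i @ F --> u i s) -> F --> s.
Proof.
move=> FF h.
suff hp : (fun t => u ^~ t : prod_topology Y) @ F --> (u ^~ s : prod_topology Y).
  move=> A [_ /= [[W oW <-]] Ws /filterS]; apply; apply: hp; exact: open_nbhs_nbhs.
apply/cvg_sup => i A [_ /= [[W oW <-]] Ws /filterS]; apply.
by apply: (h i); exact: open_nbhs_nbhs.
Qed.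

Lemma initial_pull i (g : Y i -> R) (s : X) : smooth_at g (u i s) -> smooth_at (g \o u i : X -> R) s.
Proof.
move=> sg; exists 1%N, (fun=> g \o u i), (fun v => v 0 0); split.
- by move=> _; exists i, g.
- exact: smooth_on_coord.
- by apply: filterE => t; rewrite mxE.
Qed.

Lemma initial_proj_smooth i : smooth_map (u i : X -> Y i).
Proof. by move=> s; split; [exact: initial_u_continuous|move=> g; exact: initial_pull]. Qed.

Lemma initial_composition_closed : composition_closed X.
Proof.
move=> m h F s sh sF.
have [F' sF' FF'] := Rn_smooth_extend sF.
pose W j (w : {k : nat & (('I_k -> S -> R) * ('rV[R]_k -> R))%type}) :=
  [/\ forall i, pulled_back u ((projT2 w).1 i) s, smooth_on setT (projT2 w).2
    & \forall t \near s, h j t = (projT2 w).2 (\row_i (projT2 w).1 i t)].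
have exW j : exists w, W j w.
  have [k [g [G [h1 h2 h3]]]] := sh j.
  by exists (existT _ k (g, G)).
have [w hw] := choice exW.
(* The arguments of all the [h j] are gathered into one family indexed by pairs. *)
pose K := {j : 'I_m & 'I_(projT1 (w j))}.
pose hK (k : 'I_#|{: K}|) := (projT2 (w (tag (enum_val k)))).1 (tagged (enum_val k)).
pose sel j (x : 'rV[R]_#|{: K}|) := \row_i x 0 (enum_rank (Tagged (fun j => 'I_(projT1 (w j))) i : K)) : 'rV[R]_(projT1 (w j)).
exists #|{: K}|, hK, (fun x => F' (\row_j (projT2 (w j)).2 (sel j x))); split.
- by move=> k; have [h1 _ _] := hw (tag (enum_val k)); exact: h1.
- move=> k; apply: (Ck_comp openT openT) => // j.
  apply: (Ck_comp openT openT) => // [|i]; last exact: smooth_on_coord.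
  by have [_ h2 _] := hw j; exact: h2.
- have N1 : \forall t \near s, forall j, h j t = (projT2 (w j)).2 (\row_i (projT2 (w j)).1 i t).
    apply: (@filter_forall _ _ (fun j t => h j t = (projT2 (w j)).2 (\row_i (projT2 (w j)).1 i t)) (nbhs s)).
    by move=> j; case: (hw j).
  have cr : {for s, continuous (fun t : X => \row_j h j t)}.
    apply: (@continuous_row R m X h s) => j.
  exact: smooth_continuous (sh j).
  have N2 : \forall t \near s, F (\row_j h j t) = F' (\row_j h j t) by exact: cr FF'.
  apply: filterS2 N1 N2 => t e ->; congr F'; apply/rowP => j; rewrite !mxE e.
  congr (_ _); apply/rowP => i; rewrite !mxE /hK.
  by rewrite enum_rankK.
Qed.

(** Smoothness of [f \o w], for [f] smooth on an initial space, involves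
    composites of [F] with functions on [Z]; hence the assumption on [Z]. *)
Lemma smooth_into_initial (Z : smoothSpace R) (w : Z -> X) (z : Z) : composition_closed Z ->
  (forall i, smooth_map_at (u i \o w : Z -> Y i) z) -> smooth_map_at w z.
Proof.
move=> cZ hw.
have cw : {for z, continuous w}.
  have h i : u i @ (w @ z) --> u i (w z) by case: (hw i).
  exact: initial_cvg h.
split=> // f [m [h [F [hh sF ff]]]].
have ff' : \forall t \near z, F (\row_j (h j \o w) t) = (f \o w) t.
  have N : \forall t \near z, f (w t) = F (\row_j h j (w t)) := cw _ ff.
  by apply: filterS N => t /= ->.
apply: (smooth_near ff'); apply: cZ; last exact: Rn_smooth_global.
move=> j; have [i [g [sg ->]]] := hh j; have [_ hi] := hw i; exact: (hi g sg).
Qed.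

End Initial.

Lemma smooth_into_euclidean m (Z : smoothSpace R) (w : Z -> euclidean R m) (z : Z) :
  composition_closed Z -> (forall j, smooth_at (fun t => (w t : 'rV[R]_m) 0 j) z) ->
  smooth_map_at w z.
Proof.
move=> cZ hw.
have wE : w = (fun t => \row_j (w t : 'rV[R]_m) 0 j).
  by apply/funext => t; apply/rowP => j; rewrite mxE.
split.
  rewrite wE; apply: (@continuous_row R m Z (fun j t => (w t : 'rV[R]_m) 0 j)) => j.
  exact: smooth_continuous (hw j).
move=> f sf; rewrite wE in sf; have := cZ m _ f z hw sf.
by apply: smooth_near; apply: filterE => t /=; congr f; apply/rowP => j; rewrite mxE.
Qed.

Lemma smooth_into_initial2 (X Y : smoothSpace R) S (u : S -> X) (v : S -> Y)
    (Z : smoothSpace R) (w : Z -> initial2_space u v) z : composition_closed Z ->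
  smooth_map_at (u \o w) z -> smooth_map_at (v \o w) z -> smooth_map_at w z.
Proof. by move=> cZ h1 h2; apply: smooth_into_initial => // -[]. Qed.

Lemma initial2_fst (X Y : smoothSpace R) S (u : S -> X) (v : S -> Y) :
  smooth_map (u : initial2_space u v -> X).
Proof. exact: (@initial_proj_smooth _ _ _ (pair_maps u v) true). Qed.

Lemma initial2_snd (X Y : smoothSpace R) S (u : S -> X) (v : S -> Y) :
  smooth_map (v : initial2_space u v -> Y).
Proof. exact: (@initial_proj_smooth _ _ _ (pair_maps u v) false). Qed.

Lemma smooth_coord m (X : smoothSpace R) (w : X -> euclidean R m) x j :
  smooth_map_at w x -> smooth_at (fun t => (w t : 'rV[R]_m) 0 j) x.
Proof.
move=> [_ sw]; apply: (sw (fun v : 'rV[R]_m => v 0 j)).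
by apply: Rn_smooth_global; exact: smooth_on_coord.
Qed.

Lemma smooth_sum (X : smoothSpace R) (J : Type) (r : seq J) (f : J -> X -> R) x :
  (forall j, smooth_at (f j) x) -> smooth_at (fun t => \sum_(j <- r) f j t) x.
Proof.
move=> sf; elim: r => [|j r IH].
  by apply: smooth_near (smooth_cst 0 x); apply: filterE => t; rewrite big_nil.
by apply: smooth_near (smoothD (sf j) IH); apply: filterE => t; rewrite big_cons.
Qed.

End SmoothMaps.

(** * Linear functionals as smooth functions *)

Section Functionals.
Variable R : realType.

Definition functional (V : lmodType R) (lam : V -> R) : Prop :=
  forall c x y, lam (c *: x + y) = c * lam x + lam y.

Lemma functional_sum (V : lmodType R) (lam : V -> R) m (c : 'I_m -> R) (x : 'I_m -> V) :
  functional lam -> lam (\sum_i c i *: x i) = \sum_i c i * lam (x i).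
Proof.
move=> hl; have l0 : lam 0 = 0.
  have := hl 1 0 0; rewrite scale1r addr0 mul1r => e.
  by apply: (addIr (lam 0)); rewrite -e add0r.
elim/big_ind2: _ => // [a b a' b' <- <-|i _].
  by rewrite -[X in lam (X + _)]scale1r hl mul1r.
by rewrite -[X in lam X]addr0 hl l0 addr0.
Qed.

Lemma functional_coord (V : vectType R) (lam : V -> R) a : functional lam ->
  lam a = \sum_i coord (vbasis fullv) i a * lam (vbasis fullv)`_i.
Proof. by move=> hl; rewrite {1}(coord_vbasis (memvf a)) functional_sum. Qed.

Lemma coord_functional (V : vectType R) m (X : m.-tuple V) i : functional (coord X i).
Proof. by move=> c x y; rewrite linearP. Qed.

Lemma functional_smooth (Z : smoothSpace R) (C : falgType R) (w : Z -> C) (lam : C -> R) z :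
  functional lam -> smooth_map_at (fun t => coordinates (w t) : euclidean R _) z ->
  smooth_at (fun t => lam (w t)) z.
Proof.
move=> hl sw.
have -> : (fun t => lam (w t)) = (fun t => \sum_i
    (coordinates (w t) : 'rV[R]_(\dim {:C})) 0 i * lam (vbasis {:C})`_i).
  apply/funext => t; rewrite (functional_coord (w t) hl).
  by apply: eq_bigr => i _; rewrite mxE.
apply: smooth_sum => i.
by apply: smoothM; [exact: smooth_coord sw|exact: smooth_cst].
Qed.

Lemma coordinates_smooth (Z : smoothSpace R) (C : falgType R) (w : Z -> C) z :
  composition_closed Z -> (forall lam, functional lam -> smooth_at (fun t => lam (w t)) z) ->
  smooth_map_at (fun t => coordinates (w t) : euclidean R _) z.
Proof.
move=> cZ hw; apply: smooth_into_euclidean => // j.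
apply: smooth_near (hw _ (coord_functional (vbasis {:C}) j)).
by apply: filterE => t; rewrite mxE.
Qed.

Lemma weil_bundle_functional n (M : manifold R n) (C : falgType R) (g : smooth_fun M)
    (lam : C -> R) (p : weil_bundle M C) :
  functional lam -> smooth_at (fun q : weil_bundle M C => lam (weil_mor q g)) p.
Proof.
move=> hl; apply: functional_smooth => //.
exact: (@initial_proj_smooth R _ _ (fun=> euclidean R (\dim {:C}))
  (fun f (q : {lrmorphism smooth_fun M -> C}) => coordinates (q f)) g p).
Qed.

End Functionals.

(** * The fibres of the projection *)

Section AffineBundle.
Variables (R : realType) (n : nat) (M : manifold R n) (A : weilAlgebra R).
Variables (B : falgType R) (phi : {lrmorphism A -> B}) (J : {vspace A}) (N : nat).
Hypothesis phiJ : is_quotient phi J.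
Hypothesis JA : (J <= weil_max A)%VS.
Hypothesis idealJ : forall a b : A, b \in J -> a * b \in J.
Hypothesis nilA : nilpotent_max A N.
Implicit Types (f g : smooth_fun M) (p q : weil_bundle M A) (b : weil_bundle M B).

Let WB : weilAlgebra R := weil_quotient phiJ JA nilA.
Let nilB : nilpotent_max WB N. Proof. exact: weil_quotient_nilpotent. Qed.

Lemma phi_onto x : exists a, phi a = x. Proof. by case: phiJ. Qed.
Lemma phi_ker a : (phi a == 0) = (a \in J). Proof. by case: phiJ. Qed.

Lemma phi_alg (c : R) : phi c%:A = c%:A.
Proof. by rewrite linearZ /= rmorph1. Qed.

Lemma weil_projP p b :
  weil_proj phi p = b <-> forall f, phi (weil_mor p f) = weil_mor b f.
Proof.
split=> [<- //|h].
by apply: lrmorphism_eq => f; exact: h.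
Qed.

Lemma same_proj_sub p q f : weil_proj phi p = weil_proj phi q ->
  weil_mor p f - weil_mor q f \in J.
Proof.
move=> e; rewrite -phi_ker rmorphB /= subr_eq0; apply/eqP.
by have /weil_projP/(_ f) := e.
Qed.

Lemma weil_proj_based p z : based p z ->
  @based R n M WB (weil_proj phi p : {lrmorphism smooth_fun M -> B}) z.
Proof.
move=> pz f; rewrite [weil_proj phi p f]/(phi (weil_mor p f)).
have -> : phi (weil_mor p f) - (f z)%:A = phi (weil_mor p f - (f z)%:A).
  by rewrite (raddfB phi) /= phi_alg.
by rewrite weil_quotient_max; exact: pz.
Qed.

(** A point [b] is lifted by lifting the increments of the coordinates from
    [B] to [A] and taking the Taylor morphism; [point_ext] in [B] shows that its
    projection is [b]. *)
Lemma weil_proj_onto b : exists p, weil_proj phi p = b.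
Proof.
have [z bz] := @based_exists R n M WB b.
have [L _ L1] := local_coords_exist (filterT : nbhs z setT).
have Lz : lc_bump L z != 0 by rewrite (nbhs_singleton L1) oner_neq0.
have [a ha] := choice (fun i => phi_onto (weil_mor b (lc_X L i) - (lc_X L i z)%:A)).
have am i : a i \in weil_max A.
  by rewrite -(weil_quotient_max phiJ JA nilA) ha; exact: bz.
pose p : weil_bundle M A := taylor_mor L z am nilA.
have pz : based p z by exact: taylor_based.
exists p; apply: lrmorphism_eq.
apply: (point_ext nilB Lz (weil_proj_based pz) bz) => i.
have pX : weil_mor p (lc_X L i) = (lc_X L i z)%:A + a i by exact: (taylor_X am nilA Lz).
suff : phi (weil_mor p (lc_X L i)) = weil_mor b (lc_X L i) by [].
by rewrite pX (raddfD phi) /= phi_alg ha addrC subrK.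
Qed.

(** All derivations over [p] are of this form, by [derivation_from_coordsX] and
    [derivation_ext]: these three lemmas identify them with [n]-tuples of
    elements of [J]. *)
Lemma derivation_from_coords (L : local_coords M) p (s : 'I_n -> A) :
  (forall i, s i \in J) ->
  derivations J p (fun f => \sum_i weil_mor p (lc_d L i f) * s i).
Proof.
move=> sJ; split=> [c f g|f|f g].
- rewrite scaler_sumr -big_split; apply: eq_bigr => i _.
  by rewrite lc_d_linear (linearP (weil_mor p)) mulrDl scalerAl.
- by apply: memv_suml => i _; exact: idealJ.
- rewrite !mulr_sumr -big_split; apply: eq_bigr => i _.
  by rewrite lc_dM (rmorphD (weil_mor p)) !(rmorphM (weil_mor p)) mulrDl !mulrA.
Qed.

Lemma derivation_from_coordsX (L : local_coords M) (C : weilAlgebra R)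
    (p : {lrmorphism smooth_fun M -> C}) z (s : 'I_n -> C) j :
  based p z -> lc_bump L z != 0 -> \sum_i p (lc_d L i (lc_X L j)) * s i = s j.
Proof.
move=> pz Lz.
have pd i : p (lc_d L i (lc_X L j)) = (i == j)%:R.
  apply/eqP; rewrite -subr_eq0; apply/eqP.
  have -> : p (lc_d L i (lc_X L j)) - (i == j)%:R = p (lc_d L i (lc_X L j) - (i == j)%:R).
    by rewrite (raddfB p) /= rmorph_nat.
  apply: (point_local pz); apply: filterS (lc_dX i j Lz) => w e.
  by rewrite sfB e; case: (i == j); rewrite ?sf1 ?sf0 subrr.
rewrite (bigD1 j) //= pd eqxx mul1r big1 ?addr0// => i /negbTE ij.
by rewrite pd ij mul0r.
Qed.

Lemma derivation_ext (L : local_coords M) p z D D' : based p z -> lc_bump L z != 0 ->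
  derivations J p D -> derivations J p D' -> (forall i, D (lc_X L i) = D' (lc_X L i)) -> D = D'.
Proof.
move=> pz Lz [DL _ DM] [DL' _ DM'] e; apply/funext => f; apply/eqP; rewrite -subr_eq0; apply/eqP.
apply: (@tder_eq0 R n M A p p z (fun f => D f - D' f) pz pz _ _ L N nilA Lz) => [c g h|g h|i].
- by rewrite DL DL' opprD addrACA -scalerBr.
- by rewrite DM DM' opprD addrACA -!mulrBr.
- by rewrite e subrr.
Qed.

Section SquareZero.
Hypothesis JJ : forall a b : A, a \in J -> b \in J -> a * b = 0.

Lemma mulJ_eq (a a' b : A) : a - a' \in J -> b \in J -> a * b = a' * b.
Proof. by move=> aa bJ; apply/eqP; rewrite -subr_eq0 -mulrBl JJ. Qed.

Lemma derivations_eq p q : weil_proj phi p = weil_proj phi q -> derivations J p = derivations J q.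
Proof.
have sub p' q' : weil_proj phi p' = weil_proj phi q' -> derivations J p' `<=` derivations J q'.
  move=> e D [DL DJ DM]; split=> // f g; rewrite DM.
  by congr (_ + _); apply: mulJ_eq => //; exact: same_proj_sub.
by move=> e; apply/seteqP; split; exact: sub.
Qed.

Lemma model_spaceE b p : weil_proj phi p = b -> model_space phi J b = derivations J p.
Proof.
move=> pb; apply/seteqP; split=> D.
  by move=> [q qb]; rewrite (@derivations_eq q p) // pb.
by move=> Dp; exists p.
Qed.

(** [p + D] is multiplicative because the product of two values of [D] is
    zero. *)
Lemma translate_exists p D : derivations J p D ->
  exists q : {lrmorphism smooth_fun M -> A}, q =1 weil_mor p \+ D.
Proof.
move=> [DL DJ DM].
have D0 : D 1 = 0.
  have := DM 1 1; rewrite !(rmorph1 (weil_mor p)) !mul1r => e.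
  by apply: (addIr (D 1)); rewrite -e add0r.
have L : linear (weil_mor p \+ D).
  by move=> c f g /=; rewrite (linearP (weil_mor p)) DL addrACA scalerDr.
have Mm : monoid_morphism (weil_mor p \+ D).
  split=> [|f g] /=; first by rewrite (rmorph1 (weil_mor p)) D0 addr0.
  rewrite (rmorphM (weil_mor p)) DM mulrDl !mulrDr (JJ (DJ f) (DJ g)) addr0 -addrA.
  by rewrite [D f * _]weil_mulC.
by exists (mk_lrmorphism L Mm).
Qed.

(** The defect of the Leibniz rule is [(q f - p f) * (q g - p g)], a product of
    two elements of [J]. *)
Lemma difference_derivation p q : weil_proj phi p = weil_proj phi q ->
  derivations J p (fun f => weil_mor q f - weil_mor p f).
Proof.
move=> e; split=> [c f g|f|f g].
- by rewrite (linearP (weil_mor p)) (linearP (weil_mor q)) scalerBr opprD addrACA.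
- by apply: same_proj_sub.
- rewrite (rmorphM (weil_mor p)) (rmorphM (weil_mor q)).
  have := JJ (same_proj_sub f (esym e)) (same_proj_sub g (esym e)).
  rewrite mulrBl !mulrBr => /eqP; rewrite subr_eq0 => /eqP h.
  rewrite (weil_mulC (weil_mor p g)) (weil_mulC (weil_mor p g) (weil_mor p f)).
  by rewrite -[weil_mor q f * weil_mor q g](subrK (weil_mor q f * weil_mor p g)) h -addrA.
Qed.

Definition model_set : Type :=
  {bD : weil_bundle M B * (smooth_fun M -> A) | model_space phi J bD.1 bD.2}.

Definition model_family (o : option (smooth_fun M)) : smoothSpace R :=
  if o is Some _ then euclidean R (\dim {:A}) else weil_bundle M B.

Definition model_maps (o : option (smooth_fun M)) : model_set -> model_family o :=
  match o return model_set -> model_family o with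
  | None => fun s => (sval s).1
  | Some f => fun s => coordinates ((sval s).2 f)
  end.

(** The projection and the evaluations [D |-> D f] are smooth by construction;
    conversely the values of [D] at the coordinates determine this structure
    locally, which is what the trivializations below express. *)
Definition model_total : smoothSpace R := initial_space model_maps.

Definition model_proj (e : model_total) : weil_bundle M B := (sval (e : model_set)).1.

Definition model_vec (e : model_total) : smooth_fun M -> A := (sval (e : model_set)).2.

Lemma model_proj_smooth : smooth_map model_proj.
Proof. exact: (@initial_proj_smooth R _ _ _ model_maps None). Qed.

Lemma model_vec_smooth f lam e : functional lam ->
  smooth_at (fun e => lam (model_vec e f)) e.
Proof.
move=> hl; apply: functional_smooth => //.
exact: (@initial_proj_smooth R _ _ _ model_maps (Some f) e).
Qed.

Lemma model_total_eq (e e' : model_total) : model_proj e = model_proj e' -> model_vec e = model_vec e' -> e = e'.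
Proof.
case: e e' => [[b D] h] [[b' D'] h']; rewrite /model_proj /model_vec /= => e1 e2.
by subst b' D'; congr exist; exact: Prop_irrelevance.
Qed.

Lemma smooth_into_model (Z : smoothSpace R) (w : Z -> model_total) z : composition_closed Z ->
  smooth_map_at (model_proj \o w) z ->
  (forall f lam, functional lam -> smooth_at (fun t => lam (model_vec (w t) f)) z) ->
  smooth_map_at w z.
Proof.
move=> cZ h1 h2; apply: smooth_into_initial => // -[f|]; last exact: h1.
by apply: (@coordinates_smooth R Z A (fun t => model_vec (w t) f)) => // lam; exact: h2.
Qed.

Lemma model_composition_closed : composition_closed model_total.
Proof. exact: initial_composition_closed. Qed.

Lemma model_fibre b : set_bij (model_proj @^-1` [set b]) (model_space phi J b) model_vec.
Proof.
split.
- by move=> [[b' D] h] /= <-.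
- by move=> e e' /[!inE] /= eb e'b; apply: model_total_eq; rewrite eb.
- by move=> D Db; exists (exist _ (b, D) Db).
Qed.

(** Over the open set [U] of the points based where the bump of [L] does not
    vanish, derivations are read off from their values on the coordinates. *)
Section Trivialization.
Variable L : local_coords M.

Let d : nat := \dim J.
Let U : set (weil_bundle M B) := [set b | residue (weil_mor b (lc_bump L) : WB) != 0].

Lemma trivial_open : open U.
Proof.
have hl : functional (fun x : WB => residue x) by move=> c x y; rewrite residue_linear.
rewrite openE => b Ub.
have cr : {for b, continuous (fun q : weil_bundle M B => residue (weil_mor q (lc_bump L) : WB))}.
  exact: smooth_continuous (weil_bundle_functional (lc_bump L) b hl).
by apply: (cr [set x | x != 0]); apply: open_nbhs_nbhs; split=> //; exact: open_neq.
Qed.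

Lemma trivial_base b : U b -> exists2 z, @based R n M WB b z & lc_bump L z != 0.
Proof.
move=> Ub; have [z bz] := @based_exists R n M WB b; exists z => //.
by have := based_residue (lc_bump L) bz => <-.
Qed.

(** A linear section of [phi].  It is not multiplicative, but products with
    elements of [J] do not depend on the choice of a lift. *)
Definition phi_lift : 'Hom(B, A) := (linfun phi)^-1%VF.

Lemma phi_liftK x : phi (phi_lift x) = x.
Proof.
have [a <-] := phi_onto x.
have := limg_lfunVK (f := linfun phi) (x := phi a); rewrite lfunE /=; apply.
by apply/memv_imgP; exists a; rewrite ?memvf // lfunE.
Qed.

Lemma phi_lift_mul b p f a : weil_proj phi p = b -> a \in J ->
  phi_lift (weil_mor b f) * a = weil_mor p f * a.
Proof.
move=> pb aJ; apply: mulJ_eq => //.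
by rewrite -phi_ker (raddfB phi) /= phi_liftK subr_eq0; have /weil_projP -> := pb.
Qed.

(** The coordinates of the [n] elements of [J] are flattened into one row,
    because the model fibre of a vector bundle is a space of row vectors. *)
Definition increment (s : 'rV[R]_(n * d)) (i : 'I_n) : A :=
  \sum_(j < d) (vec_mx s : 'M[R]_(n, d)) i j *: (vbasis J)`_j.

Lemma incrementJ s i : increment s i \in J.
Proof.
apply: memv_suml => j _; apply: memvZ; apply: vbasis_mem.
by apply: mem_nth; rewrite size_tuple.
Qed.

(** This formula needs no point over [A] above [b], and is bilinear in [s] and the
    values of [b]: smoothness of the inverse trivialization follows at once. *)
Definition local_der (b : weil_bundle M B) (s : 'rV[R]_(n * d)) (f : smooth_fun M) : A :=
  \sum_i phi_lift (weil_mor b (lc_d L i f)) * increment s i.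

Lemma local_derE b p s : weil_proj phi p = b ->
  local_der b s = fun f => \sum_i weil_mor p (lc_d L i f) * increment s i.
Proof.
move=> pb; apply/funext => f; apply: eq_bigr => i _.
by apply: phi_lift_mul => //; exact: incrementJ.
Qed.

Lemma local_der_model b s : model_space phi J b (local_der b s).
Proof.
have [p pb] := weil_proj_onto b; rewrite (model_spaceE pb) (local_derE _ pb).
by apply: derivation_from_coords => i; exact: incrementJ.
Qed.

Lemma local_der_linear b a s t f :
  local_der b (a *: s + t) f = a *: local_der b s f + local_der b t f.
Proof.
rewrite scaler_sumr -big_split; apply: eq_bigr => i _ /=.
rewrite scalerAr -mulrDr; congr (_ * _).
rewrite scaler_sumr -big_split; apply: eq_bigr => j _ /=.
by rewrite linearP !mxE scalerDl scalerA.
Qed.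

Definition triv (e : model_total) : product_space (weil_bundle M B) (euclidean R (n * d)) :=
  (model_proj e, mxvec (\matrix_(i < n, j < d) coord (vbasis J) j (model_vec e (lc_X L i)))).

Definition untriv (w : product_space (weil_bundle M B) (euclidean R (n * d))) : model_total :=
  exist _ (w.1, local_der w.1 w.2) (local_der_model w.1 w.2).

Lemma lifted_base b p z : weil_proj phi p = b -> @based R n M WB b z -> based p z.
Proof.
move=> pb bz f; rewrite -(weil_quotient_max phiJ JA nilA) (raddfB phi) /= phi_alg.
by have /weil_projP -> := pb; exact: bz.
Qed.

Lemma local_derX b s i : U b -> local_der b s (lc_X L i) = increment s i.
Proof.
move=> Ub; have [z bz Lz] := trivial_base Ub; have [p pb] := weil_proj_onto b.
rewrite (local_derE _ pb).
exact: (derivation_from_coordsX _ _ (lifted_base pb bz) Lz).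
Qed.

Lemma trivK e : U (model_proj e) -> untriv (triv e) = e.
Proof.
move=> Ue; have [z bz Lz] := trivial_base Ue; have [p pb] := weil_proj_onto (model_proj e).
have pz := lifted_base pb bz.
have De : derivations J p (model_vec e).
  by rewrite -(model_spaceE pb); exact: (svalP (e : model_set)).
apply: model_total_eq => //.
apply: (derivation_ext pz Lz _ De) => [|i].
  by rewrite -(model_spaceE pb); exact: local_der_model.
rewrite [LHS]local_derX // /increment mxvecK.
have [_ DJ _] := De.
by rewrite [RHS](coord_vbasis (DJ _)); apply: eq_bigr => j _; rewrite mxE.
Qed.

Lemma untrivK w : U w.1 -> triv (untriv w) = w.
Proof.
move=> Uw; rewrite /triv [w in RHS]surjective_pairing; congr pair.
apply: (canLR vec_mxK); apply/matrixP => i j; rewrite mxE.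
have -> : model_vec (untriv w) (lc_X L i) = increment w.2 i by exact: local_derX.
by rewrite coord_sum_free //; exact: basis_free (vbasisP J).
Qed.

Lemma triv_smooth e : smooth_map_at triv e.
Proof.
apply: smooth_into_initial2; first exact: model_composition_closed.
  exact: model_proj_smooth.
apply: smooth_into_euclidean => [|k]; first exact: model_composition_closed.
case/mxvec_indexP: k => i j.
have := model_vec_smooth (lc_X L i) e (coord_functional (vbasis J) j).
by apply: smooth_near; apply: filterE => t; rewrite /= mxvecE mxE.
Qed.

Lemma untriv_smooth w : smooth_map_at untriv w.
Proof.
have cP : composition_closed (product_space (weil_bundle M B) (euclidean R (n * d))).
  exact: initial_composition_closed.
apply: smooth_into_model => // [|f lam hl]; first exact: initial2_fst.
have -> : (fun t => lam (model_vec (untriv t) f)) = (fun t => \sum_i \sum_(j < d)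
    (t.2 : 'rV[R]_(n * d)) 0 (mxvec_index i j) *
      lam (phi_lift (weil_mor t.1 (lc_d L i f)) * (vbasis J)`_j)).
  apply/funext => t; rewrite /model_vec /= /local_der.
  rewrite (eq_bigr (fun i => 1 *: (phi_lift (weil_mor t.1 (lc_d L i f)) * increment t.2 i))); last first.
    by move=> i _; rewrite scale1r.
  rewrite (functional_sum (fun=> 1)) //; apply: eq_bigr => i _; rewrite mul1r /increment mulr_sumr.
  rewrite (eq_bigr (fun j : 'I_d => (vec_mx (t.2 : 'rV[R]_(n * d)) : 'M[R]_(n, d)) i j *:
    (phi_lift (weil_mor t.1 (lc_d L i f)) * (vbasis J)`_j))); last first.
    by move=> j _; rewrite scalerAr.
  by rewrite functional_sum //; apply: eq_bigr => j _; rewrite mxE.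
apply: smooth_sum => i; apply: smooth_sum => j; apply: smoothM.
  by apply: smooth_coord; exact: initial2_snd.
have hlam : functional (fun x : B => lam (phi_lift x * (vbasis J)`_j)).
  by move=> c x y; rewrite linearP mulrDl -scalerAl hl.
have [_ sf] := @initial2_fst R _ _ _ fst snd w.
exact: (sf _ (weil_bundle_functional (lc_d L i f) w.1 hlam)).
Qed.

Lemma triv_diffeo : diffeo_on (model_proj @^-1` U)
  [set w : product_space (weil_bundle M B) (euclidean R (n * d)) | U w.1] triv untriv.
Proof.
split.
- split; (apply: open_comp; last exact: trivial_open).
    by move=> e _; case: (model_proj_smooth e).
  by move=> w _; case: (@initial2_fst R (weil_bundle M B) (euclidean R (n * d)) _ fst snd w).
- by move=> e Ue; split; [exact: Ue|exact: trivK].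
- by move=> w Uw; split; [exact: Uw|exact: untrivK].
- by move=> e _; exact: triv_smooth.
- by move=> w _; exact: untriv_smooth.
Qed.

End Trivialization.

Lemma model_vector_bundle :
  vector_bundle (n * \dim J) (model_space phi J) model_proj model_vec.
Proof.
split=> [b|b0]; first exact: model_fibre.
have [z bz] := @based_exists R n M WB b0.
have [L _ L1] := local_coords_exist (filterT : nbhs z setT).
exists [set b | residue (weil_mor b (lc_bump L) : WB) != 0], (triv L), (untriv L); split.
- by rewrite /= (based_residue _ bz) (nbhs_singleton L1) oner_neq0.
- exact: triv_diffeo.
- by [].
- by move=> b _ a s t; apply/funext => f; exact: local_der_linear.
Qed.

Lemma model_derivation p (e : model_total) : weil_proj phi p = model_proj e ->
  derivations J p (model_vec e).
Proof. by move=> pe; rewrite -(model_spaceE pe); exact: (svalP (e : model_set)). Qed.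

Lemma fibre_translate (s : fibre_product (weil_proj phi) model_proj) :
  exists q : {lrmorphism smooth_fun M -> A}, q =1 weil_mor (sval s).1 \+ model_vec (sval s).2.
Proof. by apply: translate_exists; exact: model_derivation (svalP s). Qed.

Definition translate (s : fibre_product (weil_proj phi) model_proj) : weil_bundle M A :=
  projT1 (cid (fibre_translate s)).

Lemma translateE s f :
  weil_mor (translate s) f = weil_mor (sval s).1 f + model_vec (sval s).2 f.
Proof. exact: (projT2 (cid (fibre_translate s)) f). Qed.

(** The components of [p + D] are sums of components of [p] and of [D]. *)
Lemma translate_smooth : smooth_map translate.
Proof.
move=> s.
have cF : composition_closed (fibre_product (weil_proj phi) model_proj).
  exact: initial_composition_closed.
apply: smooth_into_initial => // f.
apply: (@coordinates_smooth R _ A (fun s => weil_mor (translate s) f)) => // lam hl.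
have -> : (fun s => lam (weil_mor (translate s) f)) =
    (fun s : fibre_product (weil_proj phi) model_proj =>
      lam (weil_mor (sval s).1 f) + lam (model_vec (sval s).2 f)).
  by apply/funext => t; rewrite translateE -[weil_mor _ f]scale1r hl mul1r scale1r.
apply: smoothD.
  have [_ h] := @initial2_fst R _ _ _ (fun s : {s : weil_bundle M A * model_total |
    weil_proj phi s.1 = model_proj s.2} => (sval s).1) (fun s => (sval s).2) s.
  exact: (h _ (weil_bundle_functional f _ hl)).
have [_ h] := @initial2_snd R _ _ _ (fun s : {s : weil_bundle M A * model_total |
  weil_proj phi s.1 = model_proj s.2} => (sval s).1) (fun s => (sval s).2) s.
exact: (h _ (model_vec_smooth f _ hl)).
Qed.

Theorem square_zero_affine_bundle : canonical_affine_bundle M phi J.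
Proof.
split; first exact: derivations_eq.
exists (n * \dim J)%N, model_total, model_proj, model_vec, translate; split.
- exact: model_vector_bundle.
- exact: translate_smooth.
- move=> p e pe q; split; last by move=> f; rewrite translateE.
  rewrite -pe; apply/weil_projP => f; rewrite translateE (raddfD phi) /=.
  have [_ DJ _] := model_derivation pe.
  by have := DJ f; rewrite -phi_ker => /eqP ->; rewrite addr0.
- by move=> b; have [p pb] := weil_proj_onto b; exists p.
- move=> p q e; exists (fun f => weil_mor q f - weil_mor p f); split; first split.
  + by rewrite (model_spaceE (erefl (weil_proj phi p))); exact: difference_derivation.
  + by move=> f /=; rewrite addrC subrK.
  + by move=> D [_ h]; apply/funext => f; rewrite h /= addrAC subrr add0r.
Qed.

End SquareZero.

(** Take the point which increments the first coordinate by [a], the point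
    without increment, and the derivation [D] with [D X_0 = c].  Computing
    [D (X_0 * X_0)] with the Leibniz rule at the two points gives values that
    differ by [2 * (a * c)]. *)
Lemma derivations_eq_square_zero : (0 < n)%N ->
  (forall p q, weil_proj phi p = weil_proj phi q -> derivations J p = derivations J q) ->
  forall a c : A, a \in J -> c \in J -> a * c = 0.
Proof.
move=> n0 dE a c aJ cJ.
have [z _] := manifold_nonempty M.
have [L _ L1] := local_coords_exist (filterT : nbhs z setT).
have Lz : lc_bump L z != 0 by rewrite (nbhs_singleton L1) oner_neq0.
pose i0 := Ordinal n0.
have am (x : A) : x \in J -> forall i : 'I_n, (if i == i0 then x else 0) \in weil_max A.
  by move=> xJ i; case: ifP => _; [exact: (subvP JA)|exact: mem0v].
pose pt (x : A) (xJ : x \in J) : weil_bundle M A := taylor_mor L z (am x xJ) nilA.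
have ptz x xJ : based (pt x xJ) z by exact: taylor_based.
have ptX x xJ i : weil_mor (pt x xJ) (lc_X L i) = (lc_X L i z)%:A + (if i == i0 then x else 0).
  exact: (taylor_X (am x xJ) nilA Lz).
have J0 : 0 \in J by exact: mem0v.
(* The two points lie in one fibre, as their coordinates agree modulo [J]. *)
have pq : weil_proj phi (pt a aJ) = weil_proj phi (pt 0 J0).
  apply: lrmorphism_eq.
  apply: (point_ext nilB Lz (weil_proj_based (ptz a aJ)) (weil_proj_based (ptz 0 J0))) => i.
  suff : phi (weil_mor (pt a aJ) (lc_X L i)) = phi (weil_mor (pt 0 J0) (lc_X L i)) by [].
  rewrite !ptX !(raddfD phi) /=; congr (_ + _).
  by case: ifP => _ //; rewrite raddf0; apply/eqP; rewrite phi_ker.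
pose s i := if i == i0 then c else 0.
have sJ i : s i \in J by rewrite /s; case: ifP.
have Dp := derivation_from_coords L (pt a aJ) sJ.
have DX i := derivation_from_coordsX s i (ptz a aJ) Lz.
have [_ _ Mp] := Dp; have := Dp; rewrite (dE _ _ pq) => -[_ _ Mq].
have := Mp (lc_X L i0) (lc_X L i0); rewrite Mq.
rewrite !DX !ptX /s eqxx addr0 mulrDl.
rewrite [RHS]addrACA -[LHS]addr0 => /addrI /esym/eqP.
by rewrite -mulr2n -scaler_nat scaler_eq0 pnatr_eq0 => /eqP.
Qed.

End AffineBundle.

Theorem corollary1 (R : realType) (A : weilAlgebra R) (l : nat)
  (hl : height A l) (k : nat) (hk : (k <= l)%N)
  (B : falgType R) (phi : {lrmorphism A -> B})
  (hphi : is_quotient phi (weil_max A ^+ k.+1)%VS)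
  (n : nat) (M : manifold R n) :
  ((l <= 2 * k + 1)%N ->
     canonical_affine_bundle M phi (weil_max A ^+ k.+1)%VS) /\
  ((0 < n)%N -> canonical_affine_bundle M phi (weil_max A ^+ k.+1)%VS ->
     (l <= 2 * k + 1)%N).
Proof.
have nilA := height_nilpotent hl.
have ideal : ({:A} * weil_max A <= weil_max A)%VS.
  by apply/prodvP => a b _; exact: weil_maxMl.
have idealr : (weil_max A * {:A} <= weil_max A)%VS.
  by apply/prodvP => a b am _; exact: weil_maxMr.
have JA : (weil_max A ^+ k.+1 <= weil_max A)%VS.
  rewrite expvSl; apply: subv_trans idealr; exact: prodvSr (subvf _).
have idealJ (a b : A) : b \in (weil_max A ^+ k.+1)%VS -> a * b \in (weil_max A ^+ k.+1)%VS.
  move=> bJ; have : a * b \in ({:A} * (weil_max A ^+ k.+1))%VS.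
    by apply: memv_mul => //; exact: memvf.
  by rewrite expvSl prodvA; apply/subvP; exact: prodvSl.
(* [J * J] is the power [2 * k + 2] of the maximal ideal. *)
have two : (2 * k + 1).+1 = (k.+1 + k.+1)%N by rewrite mul2n -addnn addn1 addSn addnS.
split=> [lk|n0 [dE _]].
  apply: (square_zero_affine_bundle M hphi JA idealJ nilA) => a b aJ bJ.
  have := memv_mul aJ bJ; rewrite -expvD -two -(subnKC lk) -addSn expvD.
  by case: hl => _ ->; rewrite prod0v memv0 => /eqP.
have J0 := derivations_eq_square_zero hphi JA idealJ nilA n0 dE.
rewrite leqNgt; apply/negP => kl.
case: hl => /negP hl _; apply: hl.
rewrite -(subnKC kl) two expvD expvD.
have -> : (weil_max A ^+ k.+1 * weil_max A ^+ k.+1)%VS = 0%VS.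
  by apply/eqP; rewrite -subv0; apply/prodvP => a b aJ bJ; rewrite J0 ?mem0v.
by rewrite prod0v.
Qed.
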